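(* There exist positive absolute constants $b_1\in(0,\ln^2 2/16)$, $C_0,C_1,C_2$ such that the following holds. Let $\Sigma$, $\mathbf u^*$, $\lambda_1>\lambda_2\ge\dots\ge\lambda_d\ge 0$ and the samples $X^{(1)},X^{(2)},\ldots$ be as in the context, and let $\mathbf u^{(0)}\in\mathcal S^{d-1}$ be a deterministic initial point such that, for some constant $c^*>1$, $\tan^2\angle(\mathbf u^{(0)},\mathbf u^* )\le c^* d$. Then for any $\varepsilon\in(0,1/8)$, any $\beta>0$ satisfying $$d\,[\lambda_1^2(\lambda_1-\lambda_2)^{-1}\beta]^{1-2\varepsilon}\le b_1/c^*,$$ and any $t>1$, there exists an event $\mathcal H_*$ with $$\mathbb P(\mathcal H_* )\ge 1-2(d+2)N^o_\beta(c^* )\exp\left(-C_0[\lambda_1^2(\lambda_1-\lambda_2)^{-1}\beta]^{-2\varepsilon}\right)-4dN^*_{\beta,t}\exp\left(-C_1[\lambda_1^2(\lambda_1-\lambda_2)^{-1}\beta]^{-2\varepsilon}\right)$$ such that the iterates $\mathbf u^{(n)}$ of the online PCA algorithm with stepsize $\beta$ satisfy, for all integers $n\in[N^*_{\beta,1}+N^o_\beta(c^* ),\,N^*_{\beta,t}]$, $$\mathbb E\left[\tan^2\angle(\mathbf u^{(n)},\mathbf u^* );\mathcal H_*\right]\le(1-\beta(\lambda_1-\lambda_2))^{2(n-N^o_\beta(c^* ))}+C_2\sum_{k=2}^d\frac{\lambda_1\lambda_k+\lambda_1^2\left[\lambda_1^2(\lambda_1-\lambda_2)^{-1}\beta\right]^{0.5-4\varepsilon}}{\lambda_1-\lambda_k}\cdot\beta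 .$$
   Context: Notation: $\|\cdot\|$ is the Euclidean norm, $\mathcal S^{d-1}=\{\mathbf u\in\mathbb R^d:\|\mathbf u\|=1\}$, $\angle(\mathbf u,\mathbf w)=\arccos(\mathbf u^\top\mathbf w)\in[0,\pi]$ for unit vectors, $\mathbb E[X;\mathcal A]=\mathbb E[X\mathbf 1_{\mathcal A}]$, $\lceil x\rceil$ is the smallest integer $\ge x$. ''Absolute constant'' means independent of all other quantities (dimension, distribution, stepsize, etc.). For a real random variable $Y$, $\|Y\|_{\psi_2}=\sup_{p\ge1}p^{-1/2}(\mathbb E|Y|^p)^{1/p}$. Data: $\Sigma\in\mathbb R^{d\times d}$ is symmetric positive semidefinite with eigenvalues $\lambda_1>\lambda_2\ge\dots\ge\lambda_d\ge0$, and $\mathbf u^*$ is a unit eigenvector for $\lambda_1$. $Z\in\mathbb R^d$ is a random vector with $\mathbb E[Z]=0$, $\mathbb E[ZZ^\top]=\mathbf I_d$ and $\sup_{\mathbf v\in\mathcal S^{d-1}}\|\mathbf v^\top Z\|_{\psi_2}\le1$. The samples $X^{(1)},X^{(2)},\ldots$ are i.i.d. copies of $X=\Sigma^{1/2}Z$, where $\Sigma^{1/2}$ is the symmetric positive semidefinite square root of $\Sigma$. Online PCA algorithm with stepsize $\beta>0$: starting from $\mathbf u^{(0)}\in\mathcal S^{d-1}$, for $n\ge1$, $\mathbf u^{(n)}=\Pi\{\mathbf u^{(n-1)}+\beta X^{(n)}(X^{(n)})^\top\mathbf u^{(n-1)}\}$, where $\Pi\mathbf w=\mathbf w/\|\mathbf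 w\|$ for $\mathbf w\ne0$. Rescaled times: for $s>0$ and $c^*>0$, $$N^*_{\beta,s}=\left\lceil\frac{s\log(\lambda_1^{-2}(\lambda_1-\lambda_2)\beta^{-1})}{-\log(1-\beta(\lambda_1-\lambda_2))}\right\rceil,\qquad N^o_\beta(c^* )=\left\lceil\frac{\log(4c^*d)}{-\log(1-\beta(\lambda_1-\lambda_2))}\right\rceil.$$ *)

(* Defs.v *)
From HB Require Import structures.
From mathcomp Require Import all_boot all_order all_algebra finmap.
From mathcomp Require Import all_classical all_reals all_analysis.

Set Implicit Arguments.
Unset Strict Implicit.
Unset Printing Implicit Defensive.

Import Order.TTheory GRing.Theory Num.Theory.
Import numFieldNormedType.Exports.

Local Open Scope classical_set_scope.
Local Open Scope ring_scope.

Section euclidean.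
Context {R : realType} {d : nat}.
Implicit Types u v w : 'cV[R]_d.

Definition dotv u w : R := (u^T *m w) 0 0.

(* The library's norm on matrices is the sup norm, hence this definition. *)
Definition enorm u : R := Num.sqrt (dotv u u).

Definition sphere : set 'cV[R]_d := [set u | enorm u = 1].

Definition angle u w : R := acos (dotv u w).

(* The library's [tan] takes the value 0 at pi / 2, whereas here
   tan^2 (pi / 2) must be +oo. *)
Definition tan2_angle u w : \bar R :=
  if angle u w == pi / 2 then +oo%E else (tan (angle u w) ^+ 2)%:E.

Definition normalize w : 'cV[R]_d := (enorm w)^-1 *: w.

Definition psd (A : 'M[R]_d) : Prop :=
  A^T = A /\ forall v, 0 <= (v^T *m A *m v) 0 0.

(* These conditions determine S uniquely when A is psd. *)
Definition is_psd_sqrt (A S : 'M[R]_d) : Prop := psd S /\ S *m S = A.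

(* [lam 1, ..., lam d] are the eigenvalues of A, with multiplicity; the values
   of [lam] at other indices are irrelevant. *)
Definition has_eigenvalues (A : 'M[R]_d) (lam : nat -> R) : Prop :=
  char_poly A = \prod_(1 <= k < d.+1) ('X - (lam k)%:P).

End euclidean.

(* R^d equipped with its Borel sigma-algebra. *)
Definition borel_cV (R : realType) (d : nat) :=
  g_sigma_algebraType (@open 'cV[R]_d).

Definition psi2_norm {R : realType} {dT : measure_display}
    {T : measurableType dT} (P : probability T R) (Y : T -> R) : \bar R :=
  ereal_sup [set ((p `^ (- 2^-1))%:E * 'N[P]_(p%:E)[EFin \o Y])%E
            | p in [set p : R | 1 <= p]].

(* The library's integral of a non-integrable function is infinite, so these
   equations entail the integrability of the entries of Z and Z Z^T. *)
Definition isotropic_subgaussian {R : realType} {d : nat}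
    {dT : measure_display} {T : measurableType dT} (P : probability T R)
    (Z : {RV P >-> borel_cV R d}) : Prop :=
  [/\ forall i : 'I_d, ('E_P[fun w => (Z w : 'cV[R]_d) i 0%R] = 0)%E,
      forall i j : 'I_d, ('E_P[fun w => ((Z w : 'cV[R]_d) *m (Z w)^T)%R i j]
                          = ((1%:M : 'M[R]_d) i j)%:E)%E
    & (ereal_sup [set psi2_norm P (fun w => dotv v (Z w)) | v in sphere]
       <= 1)%E].

Definition mutually_independent {R : realType} {dT dE : measure_display}
    {T : measurableType dT} {E : measurableType dE} (P : probability T R)
    (X : nat -> {RV P >-> E}) : Prop :=
  forall (J : {fset nat}) (A : nat -> set E),
    (forall j, j \in J -> measurable (A j)) ->
    P (\bigcap_(j in [set` J]) (X j @^-1` A j))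
    = (\prod_(j <- J) P (X j @^-1` A j))%E.

(* Y may live on a different probability space. *)
Definition iid_copies {R : realType} {dT dT' dE : measure_display}
    {T : measurableType dT} {T' : measurableType dT'} {E : measurableType dE}
    (P : probability T R) (X : nat -> {RV P >-> E})
    (Q : probability T' R) (Y : T' -> E) : Prop :=
  mutually_independent X /\
  forall n (A : set E), measurable A -> P (X n @^-1` A) = Q (Y @^-1` A).

(* [x n] is the sample used at step n + 1, i.e. x 0, x 1, ... are
   X^(1), X^(2), ... *)
Fixpoint online_pca {R : realType} {d : nat} (beta : R) (u0 : 'cV[R]_d)
    (x : nat -> 'cV[R]_d) (n : nat) : 'cV[R]_d :=
  if n is m.+1 then
    let u := online_pca beta u0 x m in
    normalize (u + beta *: (x m *m (x m)^T *m u))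
  else u0.

Section rescaled_times.
Context {R : realType}.

(* Nstar and Nout are N^*_{beta,s} and N^o_beta(c); they are meaningful when
   0 < beta * (lam1 - lam2) < 1, so that the denominators are positive. *)
Definition Nstar (lam1 lam2 beta s : R) : int :=
  Num.ceil (s * ln (lam1 ^- 2 * (lam1 - lam2) * beta^-1)
            / - ln (1 - beta * (lam1 - lam2))).

Definition Nout (d : nat) (lam1 lam2 beta c : R) : int :=
  Num.ceil (ln (4 * c * d%:R) / - ln (1 - beta * (lam1 - lam2))).

Definition scaled_step (lam1 lam2 beta : R) : R :=
  lam1 ^+ 2 * (lam1 - lam2)^-1 * beta.

End rescaled_times.

(* Main.v *)
(* In an orthonormal eigenbasis of Sigma, let v be the vector of coordinates of
   the iterate divided by the coordinate along u^*, so that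
   tan^2 = T := sum_(k >= 2) v_k^2; normalising the iterates does not change v.
   With y the coordinates of the sample and S = <v, y>,
     v_k' = v_k + beta S (y_k - v_k y_1) / (1 + beta y_1 S),
   and E[S (y_k - v_k y_1)] = - (lam_1 - lam_k) v_k exactly. Replacing
   1 / (1 + x) by 1 where |x| > 1/2, and restarting from u^* when T leaves a
   region T <= L of order c^* d, gives a Markov chain that agrees with the
   algorithm on a good event.

   As long as T <= L, the fourth moments of y give
     E v_k'^2 <= (1 - 7/4 beta (lam_1 - lam_k)) v_k^2
                 + 192 beta^2 lam_1 lam_k (1 + T),
   the smallness of b_1 absorbing the noise proportional to v_k^2. Solving this
   recursion gives the bound on the expectation.

   For the good event, let p be of order r^(-2 eps), where r is the scaled
   stepsize. The assumption makes p r c^* d small, so in the expansion of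
   E (T' + const)^p the linear drift dominates all the higher order terms, which
   are controlled by the sub-Gaussian moments of order up to 4p. Hence
   E (T + const)^p stays bounded by C (5/2 c^* d)^p along the chain, and Markov's
   inequality bounds each of the probabilities of leaving T <= L or |x| <= 1/2
   by a constant times 3^(-p). *)

Require Import Defs.
From HB Require Import structures.
From mathcomp Require Import all_boot all_order all_algebra finmap.
From mathcomp Require Import all_classical all_reals all_analysis.
From mathcomp Require Import measurable_realfun ring lra.

Set Implicit Arguments.
Unset Strict Implicit.
Unset Printing Implicit Defensive.

Import Order.TTheory GRing.Theory Num.Theory.
Import numFieldNormedType.Exports.

Local Open Scope classical_set_scope.
Local Open Scope ring_scope.

(** * Independence along a chain driven by independent samples *)

(** With [g = beta * (lam_1 - lam_2)], the identity [(beta * lam_1)^2 = g * r] makes [r] the natural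
    small parameter: the quadratic noise in a region of size [L] is of order [g * r * L], a small
    fraction of the drift [g]. In the expansion of a [p]-th power, second-order terms carry [p^2]
    but the drift only [p], whence the product [p * r * cstar * d]. The value [10^9] leaves ample
    slack.

    A power is used as potential because the increments are dominated by polynomials of degree four
    in sub-Gaussian variables, whose exponential moments may be infinite; with [p] of order
    [r^(-2 eps)], Markov's inequality still yields the required exponential.

    Conditioning on the good event would spoil the exact drift. The modified chain has unconditional
    bounds at every step, and as [T >= 0], the expectation over the event is at most the full
    expectation for that chain.

    One recursion covers burn-in and convergence. At times after [Ns 1 + No] one has
    [(1 - g)^n <= r / (4 cstar d)]; since the rate 7/4 exceeds 3/2, the initial value has decayed
    below [r^(3/2)], which fits into the term [k = 2] of the final sum. *)

Lemma measure_eq_rectangles d1 d2 (T1 : measurableType d1)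
    (T2 : measurableType d2) (R : realType)
    (m1 m2 : {measure set (T1 * T2) -> \bar R}) :
  (m1 setT < +oo)%E ->
  (forall A B, measurable A -> measurable B -> m1 (A `*` B) = m2 (A `*` B)) ->
  forall G, measurable G -> m1 G = m2 G.
Proof.
move=> m1T m12 G mG.
pose C : set (set (T1 * T2)) :=
  [set C | exists A, measurable A /\ exists B, measurable B /\ C = A `*` B].
apply: (measure_unique C (fun=> setT)) => //.
- rewrite measurable_prod_measurableType //; congr (<<s _ >>).
  rewrite predeqE; split => [[A mA [B mB <-]]|[A [mA [B [mB ->]]]]].
    by exists A; split => //; exists B.
  by exists A => //; exists B.
- move=> _ _ [X1 [mX1 [X2 [mX2 ->]]]] [Y1 [mY1 [Y2 [mY2 ->]]]].
  rewrite -setXI; exists (X1 `&` Y1); split; first exact: measurableI.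
  by exists (X2 `&` Y2); split => //; exact: measurableI.
- by move=> _; exists setT; split => //; exists setT; split => //; rewrite setXTT.
- by rewrite bigcup_const//; exists 0%N.
- by move=> _ [A [mA [B [mB ->]]]]; exact: m12.
Qed.

Definition image_measure d1 d2 (T1 : measurableType d1) (T2 : measurableType d2)
  (R : realType) (m : {measure set T1 -> \bar R}) (f : T1 -> T2)
  (mf : measurable_fun setT f) : {measure set T2 -> \bar R}.
Proof. by refine [the {measure set T2 -> \bar R} of pushforward m f]. Defined.

Fixpoint chain (V E : Type) (Phi : V * E -> V) (v0 : V) (x : nat -> E) n :=
  if n is m.+1 then Phi (chain Phi v0 x m, x m) else v0.

Section markov_chain.
Context (R : realType) (dV dE dP : measure_display) (V : measurableType dV)
  (E : measurableType dE) (Omega : measurableType dP)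
  (P : probability Omega R) (X : nat -> {RV P >-> E}) (mu : probability E R)
  (Phi : V * E -> V) (v0 : V).
Hypotheses (Xindep : mutually_independent X)
  (Xmu : forall n A, measurable A -> P (X n @^-1` A) = mu A)
  (mPhi : measurable_fun [set: V * E] Phi).

Let vn n w := chain Phi v0 (fun k => X k w) n.

Lemma measurable_chain n : measurable_fun setT (vn n).
Proof.
elim: n => [|n ih]; first exact: measurable_cst.
by apply: measurableT_comp => //; apply/measurable_fun_pairP; split.
Qed.

Let pair n w := (vn n w, X n w).

Lemma measurable_chain_pair n : measurable_fun setT (pair n).
Proof.
by apply/measurable_fun_pairP; split; [exact: measurable_chain|].
Qed.

Let mpre d1 d2 (T1 : measurableType d1) (T2 : measurableType d2) (f : T1 -> T2)
  A : measurable_fun setT f -> measurable A -> measurable (f @^-1` A).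
Proof. by move=> mf mA; rewrite -[X in measurable X]setTI; exact: mf. Qed.

(* Independence from all the future samples, not only the next one, is what the
   induction on n carries through. *)
Lemma chain_future_indep n (J : {fset nat}) (B : nat -> set E) A :
  measurable A -> (forall j, j \in J -> (n <= j)%N) ->
  (forall j, j \in J -> measurable (B j)) ->
  P (vn n @^-1` A `&` \bigcap_(j in [set` J]) (X j @^-1` B j)) =
  (P (vn n @^-1` A) * \prod_(j <- J) P (X j @^-1` B j))%E.
Proof.
elim: n J B A => [|n ih] J B A mA Jn mB.
  have [Av|Av] := pselect (A v0).
    have -> : vn 0 @^-1` A = setT by apply/seteqP; split.
    by rewrite setTI probability_setT mul1e Xindep.
  have -> : vn 0 @^-1` A = set0 by apply/seteqP; split.
  by rewrite set0I measure0 mul0e.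
pose C := \bigcap_(j in [set` J]) (X j @^-1` B j).
have mC : measurable C.
  apply: bigcap_measurableType => j /= jJ; by apply: mpre; [|exact: mB].
have PC : P C = (\prod_(j <- J) P (X j @^-1` B j))%E by exact: Xindep.
have mpair := measurable_chain_pair n.
have PCfin : P C \is a fin_num by exact: fin_num_measure.
rewrite -/C -PC.
have [c Pc] : exists c : {nonneg R}, P C = c%:num%:E.
  have c0 : 0 <= fine (P C) by rewrite fine_ge0.
  by exists (NngNum c0); rewrite /= fineK.
(* The two sides of the claim are the values of these measures at the preimage of [A] under [Phi].
   They are compared on rectangles, which suffices because [m1] is finite. *)
pose m1 : {measure set (V * E) -> \bar R} := image_measure (mrestr P mC) mpair.
pose m2 : {measure set (V * E) -> \bar R} := mscale c (image_measure P mpair).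
have m1E G : m1 G = P (pair n @^-1` G `&` C) by [].
have m2E G : m2 G = (P C * P (pair n @^-1` G))%E by rewrite Pc.
have mlt : (m1 setT < +oo)%E.
  rewrite m1E ltey_eq fin_num_measure//.
  by apply: measurableI => //; exact: mpre.
have nJ : n \notin J by apply/negP => /Jn; rewrite ltnn.
have mrect A1 B1 : measurable A1 -> measurable B1 -> m1 (A1 `*` B1) = m2 (A1 `*` B1).
  move=> mA1 mB1; rewrite m1E m2E.
  (* The constraint on sample [n] joins those on later samples, so the induction hypothesis applies
     with [n] added to [J]; a second use, with the singleton of [n], factors the rectangle alone. *)
  pose B' j := if j == n then B1 else B j.
  have B'n : B' n = B1 by rewrite /B' eqxx.
  have B'J j : j \in J -> B' j = B j.
    by move=> jJ; rewrite /B'; case: eqP => // jn; rewrite jn (negbTE nJ) in jJ.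
  have mB' j : measurable (B' j) -> measurable (X j @^-1` B' j).
    by move=> ?; exact: mpre.
  have mB'J : forall j, j \in (n |` J)%fset -> measurable (B' j).
    by move=> j; rewrite in_fset1U => /orP[/eqP->|jJ]; rewrite ?B'n// B'J//; exact: mB.
  have -> : pair n @^-1` (A1 `*` B1) `&` C =
      vn n @^-1` A1 `&` \bigcap_(j in [set` (n |` J)%fset]) (X j @^-1` B' j).
    apply/seteqP; split => [w [[/= wA wB] wC]|w [/= wA wB]].
      split => // j /=; rewrite in_fset1U => /orP[/eqP->|jJ]; rewrite ?B'n// B'J//.
      exact: wC.
    split; first split => //=.
      by have /= := wB n; rewrite in_fset1U eqxx B'n; apply.
    by move=> j jJ; have /= := wB j; rewrite in_fset1U jJ orbT B'J//; apply.
  rewrite ih//; last first.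
    by move=> j; rewrite in_fset1U => /orP[/eqP->//|/Jn]; exact: ltnW.
  have -> : pair n @^-1` (A1 `*` B1) =
      vn n @^-1` A1 `&` \bigcap_(j in [set` [fset n]%fset]) (X j @^-1` B' j).
    apply/seteqP; split => [w [/= wA wB]|w [/= wA wB]].
      by split => // j /=; rewrite in_fset1 => /eqP->; rewrite B'n.
    by split => //=; have /= := wB n; rewrite in_fset1 eqxx B'n; apply.
  rewrite ih//; last 2 first.
    by move=> j; rewrite in_fset1 => /eqP->.
    by move=> j; rewrite in_fset1 => /eqP->; rewrite B'n.
  rewrite big_seq_fset1 big_fsetU1//= PC muleA [RHS]muleC.
  by congr (_ * _)%E; apply: eq_big_seq => j jJ; rewrite B'J.
have := measure_eq_rectangles mlt mrect (mpre mPhi mA).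
by rewrite m1E m2E muleC.
Qed.

(** This replaces conditioning on the past: the state depends on earlier samples only, so its joint
    law with the next sample is a product and Tonelli applies. *)
Lemma ge0_integral_chain (n : nat) (F : (V * E)%type -> \bar R) :
  measurable_fun [set: (V * E)%type] (F : _ -> \bar R) -> (forall z, (0 <= F z)%E) ->
  (\int[P]_w F (vn n w, X n w) = \int[P]_w \int[mu]_x F (vn n w, x))%E.
Proof.
move=> mF F0; have mpair := measurable_chain_pair n.
pose vnRV : {mfun Omega >-> V} :=
  HB.pack (vn n) (isMeasurableFun.Build _ _ _ _ _ (measurable_chain n)).
pose pairRV : {mfun Omega >-> (V * E)%type} :=
  HB.pack (pair n) (isMeasurableFun.Build _ _ _ _ _ mpair).
pose nu : probability V R := distribution P vnRV.
have law : forall G, measurable G -> (nu \x mu)%E G = distribution P pairRV G.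
  apply: product_measure_unique => A B mA mB.
  have := @chain_future_indep n [fset n]%fset (fun=> B) A mA.
  rewrite big_seq_fset1 Xmu// => <-//; last by move=> j; rewrite in_fset1 => /eqP->.
  congr (P _); apply/seteqP; split => [w [/= wA wB]|w [/= wA wB]].
    by split => // j /=; rewrite in_fset1 => /eqP->.
  by split => //=; have /= := wB n; rewrite in_fset1 eqxx; apply.
transitivity (\int[distribution P pairRV]_z F z)%E.
  by rewrite ge0_integral_pushforward.
transitivity (\int[(nu \x mu)%E]_z F z)%E.
  apply: eq_measure_integral => A mA _; exact/esym/law.
rewrite fubini_tonelli1//=.
rewrite ge0_integral_pushforward//=.
- exact: measurable_chain.
- exact: measurable_fun_fubini_tonelli_F.
- by move=> v _; exact: integral_ge0.
Qed.

End markov_chain.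

(** * Means of real functions *)

Section mean.
Context (R : realType) (dE : measure_display) (E : measurableType dE)
  (mu : probability E R).
Implicit Types f g : E -> R.

(** Integrability is bundled because the real-valued integral is [fine] of the extended one, hence 0
    when that is infinite; an upper bound alone would then say nothing. *)
Definition has_mean f c :=
  mu.-integrable setT (EFin \o f) /\ \int[mu]_x f x = c.

Definition mean_le f c :=
  mu.-integrable setT (EFin \o f) /\ \int[mu]_x f x <= c.

Lemma has_mean_le f c : has_mean f c -> mean_le f c.
Proof. by case=> ? <-; split. Qed.

Lemma mean_le_trans f c c' : mean_le f c -> c <= c' -> mean_le f c'.
Proof. by case=> i fc cc'; split => //; exact: le_trans cc'. Qed.

Lemma eq_mean_le f g c : f =1 g -> mean_le f c -> mean_le g c.
Proof. by move=> /funext ->. Qed.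

Lemma eq_has_mean f g c : f =1 g -> has_mean f c -> has_mean g c.
Proof. by move=> /funext ->. Qed.

Lemma mean_cst c : has_mean (cst c) c.
Proof.
split; first exact: finite_measure_integrable_cst.
rewrite Rintegral_cst// -[RHS]mulr1; congr (_ * _).
exact: (congr1 fine (probability_setT mu)).
Qed.

Lemma meanD f g c c' : has_mean f c -> has_mean g c' -> has_mean (f \+ g) (c + c').
Proof.
move=> [mf <-] [mg <-]; split; last by rewrite RintegralD.
by rewrite [X in integrable _ _ X](_ : _ = (EFin \o f) \+ (EFin \o g))%E//; exact: integrableD.
Qed.

Lemma meanZ k f c : has_mean f c -> has_mean (fun x => k * f x) (k * c).
Proof.
move=> [mf <-]; split; last by rewrite RintegralZl.
by rewrite [X in integrable _ _ X](_ : _ = (fun x => k%:E * (EFin \o f) x)%E)//; exact: integrableZl.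
Qed.

Lemma mean_sum (I : Type) (s : seq I) (P : pred I) (f : I -> E -> R) (c : I -> R) :
  (forall i, P i -> has_mean (f i) (c i)) ->
  has_mean (fun x => \sum_(i <- s | P i) f i x) (\sum_(i <- s | P i) c i).
Proof.
move=> fc; elim: s => [|i s ih].
  rewrite big_nil; apply: eq_has_mean (mean_cst 0) => x; by rewrite big_nil.
rewrite big_cons; case: ifPn => Pi; last first.
  by apply: eq_has_mean ih => x; rewrite big_cons (negbTE Pi).
apply: eq_has_mean (meanD (fc _ Pi) ih) => x.
by rewrite big_cons Pi.
Qed.

Lemma mean_leD f g c c' : mean_le f c -> mean_le g c' -> mean_le (f \+ g) (c + c').
Proof.
move=> [mf fc] [mg gc].
have [? e] : has_mean (f \+ g) (\int[mu]_x f x + \int[mu]_x g x) by exact: meanD.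
by split => //; rewrite e; exact: lerD.
Qed.

Lemma mean_leZ k f c : 0 <= k -> mean_le f c -> mean_le (fun x => k * f x) (k * c).
Proof.
move=> k0 [mf fc].
have [? e] : has_mean (fun x => k * f x) (k * \int[mu]_x f x) by exact: meanZ.
by split => //; rewrite e; exact: ler_wpM2l.
Qed.

Lemma mean_le_sum (I : Type) (s : seq I) (P : pred I) (f : I -> E -> R) (c : I -> R) :
  (forall i, P i -> mean_le (f i) (c i)) ->
  mean_le (fun x => \sum_(i <- s | P i) f i x) (\sum_(i <- s | P i) c i).
Proof.
move=> fc.
have [? e] : has_mean (fun x => \sum_(i <- s | P i) f i x)
    (\sum_(i <- s | P i) \int[mu]_x f i x).
  by apply: mean_sum => i /fc[].
by split => //; rewrite e; apply: ler_sum => i /fc[].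
Qed.

Lemma mean_le_dom f g c : measurable_fun setT f -> (forall x, 0 <= f x <= g x) ->
  mean_le g c -> mean_le f c.
Proof.
move=> mf fg [ig gc].
have i_f : mu.-integrable setT (EFin \o f).
  apply: (le_integrable measurableT _ _ ig); first exact/measurable_EFinP.
  move=> x _ /=; rewrite lee_fin; have /andP[f0 fgx] := fg x.
  by rewrite !ger0_norm// (le_trans f0).
split => //; apply: le_trans gc; apply: le_Rintegral => //.
by move=> x _; have /andP[] := fg x.
Qed.

Lemma ge0_integral_mean_le f g c : measurable_fun setT f ->
  (forall x, 0 <= f x <= g x) -> mean_le g c -> (\int[mu]_x (f x)%:E <= c%:E)%E.
Proof.
move=> mf fg /(mean_le_dom mf fg)[i_f fc].
by rewrite -[leLHS]fineK ?lee_fin//; exact: integrable_fin_num.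
Qed.

End mean.

(** * Real inequalities *)

Lemma binomial_le_exp2 n k : ('C(n, k) <= 2 ^ n)%N.
Proof.
elim: n k => [|n ih] [|k] //; first by rewrite bin0 expn_gt0.
by rewrite binS expnS mul2n -addnn leq_add.
Qed.

Lemma expn_le_ffact m n : (n ^ m <= (n + m) ^_ m)%N.
Proof.
elim: m => [|m ih] //; rewrite expnS addnS ffactSS.
by rewrite leq_mul// -[leqLHS]addn0 ltnW// ltnS leq_add.
Qed.

(** The falling factorial of [2 j] of length [j] dominates [j ^ j] and equals the central binomial
    coefficient, at most [4 ^ j], times the factorial. *)
Lemma expnn_le j : (j ^ j <= 4 ^ j * j`!)%N.
Proof.
apply: leq_trans (expn_le_ffact j j) _.
by rewrite -bin_ffact leq_mul2r -(expnM 2 2) mul2n -addnn binomial_le_exp2 orbT.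
Qed.

(** The growth [j ^ j] of the [j]-th moments is cancelled by the factorial in the binomial
    coefficient, which makes the expansion of the potential a geometric series. *)
Lemma binomial_expnn_le p j : ('C(p, j) * j ^ j <= (4 * p) ^ j)%N.
Proof.
apply: (@leq_trans ('C(p, j) * (4 ^ j * j`!))); first by rewrite leq_mul2l expnn_le orbT.
rewrite mulnCA bin_ffact expnMn leq_mul2l; apply/orP; right.
elim: j p => // j ih [|p] //; rewrite ffactSS expnS leq_mul//.
by apply: leq_trans (ih p) _; case: j {ih} => // j; rewrite leq_exp2r.
Qed.

Section real_lemmas.
Context (R : realType).
Implicit Types a b c x y z t : R.

Lemma tangent_pow_le m (a z : R) : 0 <= a -> 0 <= z ->
  a ^+ m.+1 + m.+1%:R * a ^+ m * (z - a) <= z ^+ m.+1.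
Proof.
move=> a0 z0; elim: m => [|m ih]; first by rewrite !expr1 expr0; lra.
have h : 0 <= (z ^+ m.+1 - a ^+ m.+1) * (z - a).
  have [az|za] := leP a z.
    by rewrite mulr_ge0// subr_ge0// lerXn2r ?nnegrE.
  by rewrite mulr_le0// subr_le0 ?lerXn2r ?nnegrE// ltW.
have h2 := ler_wpM2l a0 ih.
rewrite !(exprS _ m.+1) -[m.+2%:R]natr1.
set M := m.+1%:R in h2 *; set Z := z ^+ m.+1 in h h2 *.
have h3 : a * (a ^+ m.+1 + M * a ^+ m * (z - a)) =
  a * a ^+ m.+1 + M * (a ^+ m.+1 * (z - a)) by rewrite exprS; ring.
rewrite h3 in h2; move: h h2; set A := a ^+ m.+1.
move=> *; nra.
Qed.

Lemma jensen_pow (I : Type) (s : seq I) (w z : I -> R) m :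
  (forall i, 0 <= w i) -> (forall i, 0 <= z i) -> \sum_(i <- s) w i = 1 ->
  (\sum_(i <- s) w i * z i) ^+ m.+1 <= \sum_(i <- s) w i * z i ^+ m.+1.
Proof.
move=> w0 z0 w1; set a := \sum_(i <- s) w i * z i.
have a0 : 0 <= a by apply: sumr_ge0 => i _; exact: mulr_ge0.
have -> : a ^+ m.+1 =
    \sum_(i <- s) w i * (a ^+ m.+1 + m.+1%:R * a ^+ m * (z i - a)).
  have -> : \sum_(i <- s) w i * (a ^+ m.+1 + m.+1%:R * a ^+ m * (z i - a)) =
    \sum_(i <- s) (w i * (a ^+ m.+1 - m.+1%:R * a ^+ m * a) +
       (m.+1%:R * a ^+ m) * (w i * z i)) by apply: eq_bigr => i _; ring.
  by rewrite big_split/= -mulr_suml -mulr_sumr w1 -/a; ring.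
by apply: ler_sum => i _; apply: ler_wpM2l => //; exact: tangent_pow_le.
Qed.

Lemma sum4_pow_le (a b c e : R) j : 0 <= a -> 0 <= b -> 0 <= c -> 0 <= e ->
  (a + b + c + e) ^+ j <= 4 ^+ j * (a ^+ j + b ^+ j + c ^+ j + e ^+ j).
Proof.
move=> a0 b0 c0 e0.
(* Used with [m] the largest of the four: the sum is at most [4 * m]. *)
have key (m : R) : a <= m -> b <= m -> c <= m -> e <= m ->
    m ^+ j <= a ^+ j + b ^+ j + c ^+ j + e ^+ j ->
    (a + b + c + e) ^+ j <= 4 ^+ j * (a ^+ j + b ^+ j + c ^+ j + e ^+ j).
  move=> am bm cm em mj; apply: (@le_trans _ _ ((4 * m) ^+ j)).
    by rewrite lerXn2r ?nnegrE//; lra.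
  by rewrite exprMn ler_wpM2l// exprn_ge0.
have [aj bj cj ej] : [/\ 0 <= a ^+ j, 0 <= b ^+ j, 0 <= c ^+ j & 0 <= e ^+ j].
  by split; exact: exprn_ge0.
have [ab|ba] := leP a b; have [ce|ec] := leP c e.
- have [be|eb] := leP b e; [apply: (key e)|apply: (key b)] => //; lra.
- have [be|eb] := leP b c; [apply: (key c)|apply: (key b)] => //; lra.
- have [be|eb] := leP a e; [apply: (key e)|apply: (key a)] => //; lra.
- have [be|eb] := leP a c; [apply: (key c)|apply: (key a)] => //; lra.
Qed.

(** The optimal weight is [t = B / A]. When [A] or [B] vanishes, a sufficiently large or small [t]
    refutes [0 < X]. *)
Lemma le_geomean (X A B : R) : 0 <= A -> 0 <= B ->
  (forall t, 0 < t -> X <= 8 * (t * A ^+ 2 + B ^+ 2 / t)) -> X <= 16 * (A * B).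
Proof.
move=> A0 B0 XAB; have [A00|An0] := eqVneq A 0.
  rewrite A00 in XAB *; rewrite mul0r mulr0 leNgt; apply/negP => X0.
  have t0 : 0 < 16 * (B ^+ 2 + 1) / X by rewrite divr_gt0// mulr_gt0// ltr_wpDl ?sqr_ge0.
  have := XAB _ t0; apply/negP; rewrite -ltNge expr0n/= mulr0 add0r.
  rewrite invfM invrK invfM.
  have B1 : B ^+ 2 / (B ^+ 2 + 1) < 1.
    by rewrite ltr_pdivrMr ?mul1r ?ltrDl// ltr_wpDl ?sqr_ge0.
  have := ltr_pM2l X0 (B ^+ 2 / (B ^+ 2 + 1)) 1; rewrite B1 => h.
  have -> : 8 * (B ^+ 2 * (16^-1 * (B ^+ 2 + 1)^-1 * X)) =
    2^-1 * (X * (B ^+ 2 / (B ^+ 2 + 1))) by field; rewrite gt_eqF// ltr_wpDl ?sqr_ge0.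
  lra.
have Ap : 0 < A by rewrite lt_neqAle eq_sym An0.
have [B00|Bn0] := eqVneq B 0.
  rewrite B00 mulr0 mulr0 leNgt; apply/negP => X0.
  have t0 : 0 < X / (16 * A ^+ 2) by rewrite divr_gt0// mulr_gt0// exprn_gt0.
  have := XAB _ t0; rewrite B00 expr0n/= mul0r addr0.
  have -> : 8 * (X / (16 * A ^+ 2) * A ^+ 2) = X / 2 by field; rewrite gt_eqF.
  lra.
have Bp : 0 < B by rewrite lt_neqAle eq_sym Bn0.
have := XAB (B / A) (divr_gt0 Bp Ap).
by congr (_ <= _); field; rewrite !gt_eqF.
Qed.

(* 1 / (1 + x), made bounded by an arbitrary choice of value away from 0. *)
Definition clip_inv x : R := if `|x| <= 1 / 2 then (1 + x)^-1 else 1.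

Lemma clip_inv_bounds x :
  [/\ 0 <= clip_inv x, clip_inv x <= 2 & `|clip_inv x - 1| <= 2 * `|x|].
Proof.
rewrite /clip_inv; case: ifPn => [|_]; last first.
  by split => //; [lra|rewrite subrr normr0 mulr_ge0].
rewrite ler_norml => /andP[x1 x2].
have x0 : 0 < 1 + x by lra.
have i2 : (1 + x)^-1 <= 2 by rewrite invf_ple ?posrE//; lra.
split => //; first by rewrite invr_ge0 ltW.
have -> : (1 + x)^-1 - 1 = - ((1 + x)^-1 * x) by field; rewrite gt_eqF.
by rewrite normrN normrM ler_wpM2r// ger0_norm// invr_ge0 ltW.
Qed.

End real_lemmas.

(** * One step in ratio coordinates *)

Section ratio_update.
Context (R : realType) (n : nat).
Implicit Types v z : 'I_n.+1 -> R.

Definition lin v z : R := \sum_k v k * z k.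

Definition sqn v : R := \sum_k v k ^+ 2.

(* In an orthonormal eigenbasis, let z be the coordinates of the sample and v
   those of the iterate divided by its first one, so that v ord0 = 1. One step
   of online PCA maps v to this vector, as long as clip_inv is evaluated in
   [-1/2, 1/2]. *)
Definition upd (beta : R) v z k : R :=
  v k + beta * lin v z * (z k - v k * z ord0) * clip_inv (beta * z ord0 * lin v z).

Lemma sqn_ge0 v : 0 <= sqn v.
Proof. by apply: sumr_ge0 => k _; exact: sqr_ge0. Qed.

Lemma sqnE v : sqn v = v ord0 ^+ 2 + \sum_(k < n) v (lift ord0 k) ^+ 2.
Proof. by rewrite /sqn big_ord_recl. Qed.

Lemma sqn_ge1 v : v ord0 = 1 -> 1 <= sqn v.
Proof.
move=> v1; rewrite sqnE v1 expr1n lerDl.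
by apply: sumr_ge0 => k _; exact: sqr_ge0.
Qed.

Lemma upd_ord0 beta v z : v ord0 = 1 -> upd beta v z ord0 = 1.
Proof. by move=> v1; rewrite /upd v1 mul1r subrr mulr0 mul0r addr0. Qed.

(** As [clip_inv x] differs from 1 by at most [2 * |x|], removing it from the first-order term costs
    only second order and leaves a term whose mean is explicit. In all [h ^+ 2] occurs 6 times and
    an extra [u ^+ 2 * y ^+ 2] twice; with [h ^+ 2 <= 2 z_k^2 + 2 u^2 y^2] this gives 12 and 14. *)
Lemma upd_sqr_le beta v z k : 0 <= beta ->
  upd beta v z k ^+ 2 <=
  v k ^+ 2 + (2 * beta * v k * (lin v z * (z k - v k * z ord0)) +
  beta ^+ 2 * (12 * (lin v z ^+ 2 * z k ^+ 2) +
               14 * v k ^+ 2 * (lin v z ^+ 2 * z ord0 ^+ 2))).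
Proof.
move=> b0; rewrite /upd; set S := lin v z; set c := clip_inv _.
have [c0 c2 c1] := clip_inv_bounds (beta * z ord0 * S); rewrite -/c in c0 c2 c1.
set h := z k - v k * z ord0; set u := v k; set y := z ord0 in h c1 *.
have hle : h ^+ 2 <= 2 * z k ^+ 2 + 2 * (u ^+ 2 * y ^+ 2).
  have := sqr_ge0 (z k + u * y); rewrite /h -/u; nra.
have cc : c ^+ 2 <= 4 by nra.
have bS : 0 <= beta ^+ 2 * S ^+ 2 by rewrite mulr_ge0 ?sqr_ge0.
have cross : u * h * (beta * S) * (c - 1) <=
    beta ^+ 2 * S ^+ 2 * (h ^+ 2 + u ^+ 2 * y ^+ 2).
  apply: le_trans (ler_norm _) _; rewrite normrM.
  apply: le_trans (ler_wpM2l (normr_ge0 _) c1) _.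
  rewrite !normrM (ger0_norm b0).
  have -> : `|u| * `|h| * (beta * `|S|) * (2 * (beta * `|y| * `|S|)) =
    beta ^+ 2 * `|S| ^+ 2 * (2 * (`|h| * (`|u| * `|y|))) by ring.
  rewrite real_normK ?num_real// ler_wpM2l//.
  have -> : h ^+ 2 + u ^+ 2 * y ^+ 2 = `|h| ^+ 2 + (`|u| * `|y|) ^+ 2.
    by rewrite exprMn !real_normK ?num_real.
  by have := sqr_ge0 (`|h| - `|u| * `|y|); nra.
have sq : beta ^+ 2 * S ^+ 2 * h ^+ 2 * c ^+ 2 <= beta ^+ 2 * S ^+ 2 * h ^+ 2 * 4.
  by rewrite ler_wpM2l// mulr_ge0// sqr_ge0.
have fin := ler_wpM2l bS hle.
have -> : (u + beta * S * h * c) ^+ 2 = u ^+ 2 + 2 * beta * u * (S * h) +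
  2 * (u * h * (beta * S) * (c - 1)) + beta ^+ 2 * S ^+ 2 * h ^+ 2 * c ^+ 2 by ring.
lra.
Qed.

(* Dominates the increment of sqn pointwise, with the exact first-order term. *)
Definition sqn_incr beta v z : R :=
  \sum_k (2 * beta * v k * (lin v z * (z k - v k * z ord0)) +
  beta ^+ 2 * (12 * (lin v z ^+ 2 * z k ^+ 2) +
               14 * v k ^+ 2 * (lin v z ^+ 2 * z ord0 ^+ 2))).

Lemma sqn_upd_le beta v z : 0 <= beta ->
  sqn (upd beta v z) <= sqn v + sqn_incr beta v z.
Proof.
move=> b0; rewrite /sqn /sqn_incr -big_split/=.
by apply: ler_sum => k _; exact: upd_sqr_le.
Qed.

(** The sum of [z_k^2 + v_k^2 z_0^2] counts [z_0^2] an extra [W] times. Dividing by the total weight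
    makes it a convex combination, whose powers are bounded by Jensen's inequality with no factor of
    the dimension. *)
Definition avg_weight (W : R) (k : 'I_n.+1) : R :=
  (1 + (k == ord0)%:R * W) / (n.+1%:R + W).

Lemma avg_weight_ge0 W k : 0 <= W -> 0 <= avg_weight W k.
Proof. by move=> W0; rewrite divr_ge0// addr_ge0// mulr_ge0. Qed.

Lemma sum_avg_weight W : 0 <= W -> \sum_k avg_weight W k = 1.
Proof.
move=> W0; rewrite -mulr_suml big_split/= sumr_const card_ord -mulr_suml.
rewrite (bigD1 ord0)//= big1 => [|k /negbTE-> //].
by rewrite addr0 mul1r divff// gt_eqF// ltr_wpDr.
Qed.

(* lin_sq, avg_sq and z ord0 ^+ 2 / l are squares normalised to have bounded
   moments. *)
Definition lin_sq l v z : R := lin v z ^+ 2 / (l * sqn v).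

Definition avg_sq l v z : R := \sum_k avg_weight (sqn v) k * (z k ^+ 2 / l).

(** The relative increment is controlled by [beta * l * sqrt L], whose square is linear in [L]; a
    bound with [L] in place of [sqrt L] would be too weak for the potential. Adding [L0], which is
    at least the dimension, to [sqn v] absorbs the sum over coordinates. *)
Lemma sqn_upd_dist beta l L L0 v z : 0 <= beta -> 0 < l -> v ord0 = 1 ->
  sqn v <= L -> n.+1%:R <= L0 ->
  `|sqn (upd beta v z) - sqn v| <= (sqn v + L0) *
  (6 * (beta * l * Num.sqrt L) * lin_sq l v z +
   6 * (beta * l * Num.sqrt L) * (z ord0 ^+ 2 / l) +
   4 * (beta * l * Num.sqrt L) ^+ 2 * lin_sq l v z ^+ 2 +
   4 * (beta * l * Num.sqrt L) ^+ 2 * avg_sq l v z ^+ 2).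
Proof.
move=> b0 l0 v1 WL dL0; rewrite /lin_sq /avg_sq.
set W := sqn v; set s := lin v z ^+ 2 / (l * W); set y := z ord0 ^+ 2 / l.
set rho := \sum_k _; set kappa := beta * l * _.
have W1 : 1 <= W by exact: sqn_ge1.
have L1 : 1 <= L by exact: le_trans WL.
set q := Num.sqrt L in kappa *.
have q2 : q ^+ 2 = L by rewrite sqr_sqrtr//; lra.
have q1 : 1 <= q by rewrite -[X in X <= _]sqrtr1 ler_wsqrtr.
set S := lin v z in s *; set c := clip_inv (beta * z ord0 * S).
have [c0 c2 _] := clip_inv_bounds (beta * z ord0 * S); rewrite -/c in c0 c2.
pose h k := z k - v k * z ord0.
(* [Q] is the inner product of [v] and [h], so the increment is a linear term in [S * Q] plus a
   quadratic one in [S ^+ 2 * H]. *)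
pose Q := S - W * z ord0; pose H := \sum_k h k ^+ 2.
have DE : sqn (upd beta v z) - W = 2 * (beta * c) * (S * Q) + (beta * c) ^+ 2 * (S ^+ 2 * H).
  have -> : Q = \sum_k v k * h k.
    rewrite /Q /S /W /lin /sqn mulr_suml -sumrB; apply: eq_bigr => k _.
    by rewrite /h; ring.
  rewrite /H !mulr_sumr -big_split/= /W /sqn -sumrB; apply: eq_bigr => k _.
  by rewrite /upd -/S -/c /h; ring.
have SE : S ^+ 2 = l * W * s by rewrite /s; field; rewrite !gt_eqF//; lra.
have yE : z ord0 ^+ 2 = l * y by rewrite /y; field; rewrite gt_eqF.
have s0 : 0 <= s by rewrite divr_ge0 ?sqr_ge0// mulr_ge0//; lra.
have y0 : 0 <= y by rewrite divr_ge0 ?sqr_ge0//; lra.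
have H0 : 0 <= H by apply: sumr_ge0 => k _; exact: sqr_ge0.
have rho0 : 0 <= rho.
  apply: sumr_ge0 => k _; rewrite mulr_ge0 ?avg_weight_ge0 ?divr_ge0 ?sqr_ge0//; lra.
have Hle : H <= 2 * l * (W + L0) * rho.
  apply: (@le_trans _ _ (2 * l * (n.+1%:R + W) * rho)); last first.
    rewrite ler_wpM2r// ler_wpM2l ?mulr_ge0//; last by rewrite addrC lerD2l.
    exact: ltW.
  apply: (@le_trans _ _ (\sum_k (2 * z k ^+ 2 + 2 * (v k ^+ 2 * z ord0 ^+ 2)))).
    apply: ler_sum => k _; rewrite /h.
    by have := sqr_ge0 (z k + v k * z ord0); nra.
  rewrite big_split/= -!mulr_sumr -mulr_suml -/(sqn v) -/W.
  have -> : 2 * l * (n.+1%:R + W) * rho = \sum_k 2 * ((1 + (k == ord0)%:R * W) * z k ^+ 2).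
    rewrite /rho mulr_sumr; apply: eq_bigr => k _.
    rewrite /avg_weight; field.
    by rewrite gt_eqF//= gt_eqF// ltr_wpDr//; lra.
  rewrite -mulr_sumr -mulrDr ler_wpM2l//.
  under [leRHS]eq_bigr do rewrite mulrDl mul1r.
  rewrite big_split/= lerD2l (bigD1 ord0)//= mul1r big1 ?addr0// => k /negbTE->.
  by rewrite !mul0r.
have SQ : `|S * Q| <= W * l * q * (3 / 2 * s + 1 / 2 * y).
  have -> : S * Q = S ^+ 2 - W * (S * z ord0) by rewrite /Q; ring.
  apply: le_trans (ler_normB _ _) _.
  rewrite (ger0_norm (sqr_ge0 _)) normrM (ger0_norm (_ : 0 <= W)); last lra.
  (* AM-GM with weight [q = sqrt L] balances [S ^+ 2], of size [l * L], against [z ord0 ^+ 2], of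
     size [l], and so loses only [q]. *)
  have b1 : `|S * z ord0| <= l * q * (1 / 2 * s + 1 / 2 * y).
    have b2 : q * `|S * z ord0| <= 1 / 2 * (S ^+ 2 + q ^+ 2 * z ord0 ^+ 2).
      rewrite normrM; have := sqr_ge0 (`|S| - q * `|z ord0|).
      rewrite sqrrB exprMn !real_normK ?num_real//; lra.
    rewrite SE yE q2 in b2; rewrite -(ler_pM2l (_ : 0 < q)); last lra.
    apply: le_trans b2 _.
    have -> : q * (l * q * (1 / 2 * s + 1 / 2 * y)) = 1 / 2 * (l * (L * s) + L * (l * y)).
      by rewrite -q2; ring.
    by rewrite ler_wpM2l// lerD2r -mulrA ler_wpM2l ?(ltW l0)// ler_wpM2r.
  have b3 : S ^+ 2 <= W * l * q * s.
    by rewrite SE ler_wpM2r// [l * W]mulrC ler_peMr// mulr_ge0 ?(ltW l0)//; lra.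
  have b4 : W * `|S * z ord0| <= W * (l * q * (1 / 2 * s + 1 / 2 * y)).
    by rewrite ler_wpM2l//; lra.
  by apply: le_trans (lerD b3 b4) _; rewrite le_eqVlt; apply/orP; left; apply/eqP; field.
have k0 : 0 <= kappa.
  by apply: mulr_ge0; [apply: mulr_ge0 => //; exact: ltW|lra].
have ky := mulr_ge0 k0 y0.
have ks := mulr_ge0 k0 s0.
have bc0 : 0 <= beta * c by exact: mulr_ge0.
have bc : beta * c <= 2 * beta by nra.
have G0 : 0 <= W + L0 by have := ler0n R n.+1; lra.
rewrite DE; apply: le_trans (ler_normD _ _) _.
rewrite [X in X + _]normrM (ger0_norm (_ : 0 <= 2 * _)) ?mulr_ge0//.
rewrite [X in _ + X]ger0_norm; last first.
  by apply: mulr_ge0; [exact: sqr_ge0|apply: mulr_ge0 => //; exact: sqr_ge0].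
have t1 : 2 * (beta * c) * `|S * Q| <= (W + L0) * (6 * kappa * s + 6 * kappa * y).
  apply: (@le_trans _ _ (4 * beta * (W * l * q * (3 / 2 * s + 1 / 2 * y)))).
    apply: ler_pM => //; first by rewrite mulr_ge0.
    lra.
  apply: (@le_trans _ _ (W * (6 * kappa * s + 6 * kappa * y))); last first.
    rewrite ler_wpM2r//; last by rewrite lerDl (le_trans _ dL0).
    by lra.
  have -> : 4 * beta * (W * l * q * (3 / 2 * s + 1 / 2 * y)) =
    W * (6 * kappa * s + 2 * kappa * y) by rewrite /kappa; field.
  by apply: ler_wpM2l; lra.
have t2 : (beta * c) ^+ 2 * (S ^+ 2 * H) <=
    (W + L0) * (4 * kappa ^+ 2 * s ^+ 2 + 4 * kappa ^+ 2 * rho ^+ 2).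
  apply: (@le_trans _ _ ((2 * beta) ^+ 2 * (l * L * s * (2 * l * (W + L0) * rho)))).
    apply: ler_pM; first exact: sqr_ge0.
    - by apply: mulr_ge0 => //; exact: sqr_ge0.
    - by rewrite lerXn2r ?nnegrE// mulr_ge0.
    apply: ler_pM => //; first exact: sqr_ge0.
    by rewrite SE ler_wpM2r// ler_wpM2l// ltW.
  have -> : (2 * beta) ^+ 2 * (l * L * s * (2 * l * (W + L0) * rho)) =
      (W + L0) * (4 * kappa ^+ 2 * (2 * (s * rho))).
    by rewrite /kappa -q2; ring.
  rewrite ler_wpM2l// -mulrDr; apply: ler_wpM2l.
    by apply: mulr_ge0 => //; exact: sqr_ge0.
  by have := sqr_ge0 (s - rho); nra.
apply: le_trans (lerD t1 t2) _.
by rewrite -mulrDr !addrA.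
Qed.

End ratio_update.

(** * Moments of one step *)

Section moments.
Context (R : realType) (dE : measure_display) (E : measurableType dE)
  (mu : probability E R) (n : nat) (lam : 'I_n.+1 -> R)
  (y : E -> 'I_n.+1 -> R).
Implicit Types a b v : 'I_n.+1 -> R.

(** The variance of [lin a (y x)], that is, the quadratic form of the covariance in its
    eigenbasis. *)
Definition spec_form a : R := \sum_k lam k * a k ^+ 2.

Hypotheses (lam_ge0 : forall k, 0 <= lam k)
  (lam_le : forall k, lam k <= lam ord0) (l_gt0 : 0 < lam ord0)
  (my : forall k, measurable_fun setT (fun x => y x k))
  (y_cov : forall j k, has_mean mu (fun x => y x j * y x k) ((j == k)%:R * lam k))
  (y_moment : forall a m, mean_le mu (fun x => lin a (y x) ^+ (2 * m.+1))
     ((2 * m.+1)%:R ^+ m.+1 * spec_form a ^+ m.+1)).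

Lemma spec_form_ge0 a : 0 <= spec_form a.
Proof. by apply: sumr_ge0 => k _; rewrite mulr_ge0 ?sqr_ge0. Qed.

Lemma spec_form_le a : spec_form a <= lam ord0 * sqn a.
Proof.
by rewrite /sqn mulr_sumr; apply: ler_sum => k _; rewrite ler_wpM2r ?sqr_ge0.
Qed.

Definition unitv (k j : 'I_n.+1) : R := (j == k)%:R.

Lemma lin_unitv k z : lin (unitv k) z = z k.
Proof.
rewrite /lin (bigD1 k)//= /unitv eqxx mul1r big1 ?addr0// => j /negbTE->.
by rewrite mul0r.
Qed.

Lemma spec_form_unitv k : spec_form (unitv k) = lam k.
Proof.
rewrite /spec_form (bigD1 k)//= /unitv eqxx expr1n mulr1 big1 ?addr0// => j /negbTE->.
by rewrite expr0n/= mulr0.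
Qed.

Lemma measurable_lin a : measurable_fun setT (fun x => lin a (y x)).
Proof. by apply: measurable_sum => k; apply: measurable_funM. Qed.

Lemma mean_lin_mul v k : has_mean mu (fun x => lin v (y x) * y x k) (v k * lam k).
Proof.
have h : has_mean mu (fun x => \sum_j v j * (y x j * y x k))
    (\sum_j v j * ((j == k)%:R * lam k)).
  by apply: mean_sum => j _; apply: meanZ.
have -> : v k * lam k = \sum_j v j * ((j == k)%:R * lam k).
  rewrite (bigD1 k)//= eqxx mul1r big1 ?addr0// => j /negbTE->.
  by rewrite mul0r mulr0.
apply: eq_has_mean h => x; rewrite /lin mulr_suml; apply: eq_bigr => j _; ring.
Qed.

(* The cross moments vanish, so the drift is exactly linear in v. *)
Lemma mean_drift v k : v ord0 = 1 ->
  has_mean mu (fun x => lin v (y x) * (y x k - v k * y x ord0))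
    (- (lam ord0 - lam k) * v k).
Proof.
move=> v1; have := meanD (mean_lin_mul v k) (meanZ (- v k) (mean_lin_mul v ord0)).
rewrite v1 mul1r.
have -> : v k * lam k + - v k * lam ord0 = - (lam ord0 - lam k) * v k by ring.
by apply: eq_has_mean => x /=; ring.
Qed.

Lemma mean_lin_sqr_sqr a b : mean_le mu
  (fun x => lin a (y x) ^+ 2 * lin b (y x) ^+ 2)
  (16 * (spec_form a * spec_form b)).
Proof.
(* AM-GM with a free weight t, since either variance may vanish. *)
have bound t : 0 < t -> mean_le mu (fun x => lin a (y x) ^+ 2 * lin b (y x) ^+ 2)
    (8 * (t * spec_form a ^+ 2 + spec_form b ^+ 2 / t)).
  move=> t0.
  have ha := mean_leZ (_ : 0 <= t / 2) (y_moment a 1).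
  have hb := mean_leZ (_ : 0 <= t^-1 / 2) (y_moment b 1).
  have := mean_leD (ha _) (hb _).
  have -> : t / 2 * ((2 * 2)%:R ^+ 2 * spec_form a ^+ 2) + t^-1 / 2 *
     ((2 * 2)%:R ^+ 2 * spec_form b ^+ 2) = 8 * (t * spec_form a ^+ 2 + spec_form b ^+ 2 / t).
    by rewrite natrM; field; rewrite gt_eqF.
  move=> /(_ _ _)h; apply: mean_le_dom (h _ _).
  - by apply: measurable_funM; apply: measurable_funX; exact: measurable_lin.
  - move=> x /=; rewrite mulr_ge0 ?sqr_ge0//=.
    set A := lin a _; set B := lin b _.
    have h2 := sqr_ge0 (t * A ^+ 2 - B ^+ 2).
    rewrite -(ler_pM2l t0).
    have -> : t * (t / 2 * A ^+ (2 * 2) + t^-1 / 2 * B ^+ (2 * 2)) =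
      t ^+ 2 / 2 * (A ^+ 2) ^+ 2 + 1 / 2 * (B ^+ 2) ^+ 2.
      by rewrite !exprM; field; rewrite gt_eqF.
    lra.
  - by rewrite divr_ge0 ?ltW.
  - by rewrite divr_ge0 ?invr_ge0 ?ltW.
have [i _] := bound 1 ltr01; split => //.
apply: le_geomean => [||t t0]; [exact: spec_form_ge0|exact: spec_form_ge0|].
by have [] := bound t t0.
Qed.

Lemma mean_lin_coord_sqr v k : mean_le mu
  (fun x => lin v (y x) ^+ 2 * y x k ^+ 2) (16 * (lam ord0 * sqn v * lam k)).
Proof.
have := mean_lin_sqr_sqr v (unitv k); rewrite spec_form_unitv => h.
apply: (mean_le_trans (eq_mean_le _ h)); first by move=> x; rewrite lin_unitv.
by rewrite ler_wpM2l// ler_wpM2r// spec_form_le.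
Qed.

Lemma mean_upd_sqr beta v k : v ord0 = 1 ->
  mean_le mu (fun x =>
   2 * beta * v k * (lin v (y x) * (y x k - v k * y x ord0)) +
   beta ^+ 2 * (12 * (lin v (y x) ^+ 2 * y x k ^+ 2) +
               14 * v k ^+ 2 * (lin v (y x) ^+ 2 * y x ord0 ^+ 2)))
  (- 2 * beta * (lam ord0 - lam k) * v k ^+ 2 +
   beta ^+ 2 * lam ord0 * sqn v * (192 * lam k + 224 * lam ord0 * v k ^+ 2)).
Proof.
move=> v1.
have h1 := has_mean_le (meanZ (2 * beta * v k) (mean_drift k v1)).
have c14 : 0 <= 14 * v k ^+ 2 by rewrite mulr_ge0 ?sqr_ge0.
have h2 := mean_leD (mean_leZ (ler0n R 12) (mean_lin_coord_sqr v k))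
  (mean_leZ c14 (mean_lin_coord_sqr v ord0)).
have h := mean_leD h1 (mean_leZ (sqr_ge0 beta) h2).
apply: mean_le_trans h _.
by rewrite le_eqVlt; apply/orP; left; apply/eqP; ring.
Qed.

Lemma mean_sqn_incr beta v : v ord0 = 1 ->
  mean_le mu (fun x => sqn_incr beta v (y x))
  (\sum_k (- 2 * beta * (lam ord0 - lam k) * v k ^+ 2 +
   beta ^+ 2 * lam ord0 * sqn v * (192 * lam k + 224 * lam ord0 * v k ^+ 2))).
Proof. by move=> v1; apply: mean_le_sum => k _; exact: mean_upd_sqr. Qed.

Lemma mean_lin_pow a c m : 0 < c -> spec_form a <= c ->
  mean_le mu (fun x => (lin a (y x) ^+ 2 / c) ^+ m.+1) ((2 * m.+1)%:R ^+ m.+1).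
Proof.
move=> c0 ac.
have cm : 0 <= (c ^+ m.+1)^-1 by rewrite invr_ge0 exprn_ge0// ltW.
apply: (mean_le_trans (eq_mean_le _ (mean_leZ cm (y_moment a m)))).
  by move=> x /=; rewrite exprMn exprVn -exprM mulrC.
rewrite mulrCA ler_piMr ?exprn_ge0// mulrC ler_pdivrMr ?exprn_gt0// mul1r.
by rewrite lerXn2r ?nnegrE ?spec_form_ge0// ltW.
Qed.

Lemma mean_coord_pow k m :
  mean_le mu (fun x => (y x k ^+ 2 / lam ord0) ^+ m.+1) ((2 * m.+1)%:R ^+ m.+1).
Proof.
have h := @mean_lin_pow (unitv k) (lam ord0) m l_gt0.
rewrite spec_form_unitv in h; apply: eq_mean_le (h (lam_le k)) => x.
by rewrite lin_unitv.
Qed.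

Lemma mean_lin_sq_pow v m : v ord0 = 1 ->
  mean_le mu (fun x => lin_sq (lam ord0) v (y x) ^+ m.+1) ((2 * m.+1)%:R ^+ m.+1).
Proof.
move=> v1; apply: mean_lin_pow; last exact: spec_form_le.
by rewrite mulr_gt0// (lt_le_trans ltr01)// sqn_ge1.
Qed.

Lemma mean_avg_sq_pow v m :
  mean_le mu (fun x => avg_sq (lam ord0) v (y x) ^+ m.+1) ((2 * m.+1)%:R ^+ m.+1).
Proof.
have W0 := sqn_ge0 v.
have h : mean_le mu
    (fun x => \sum_k avg_weight (sqn v) k * (y x k ^+ 2 / lam ord0) ^+ m.+1)
    (\sum_(k < n.+1) avg_weight (sqn v) k * (2 * m.+1)%:R ^+ m.+1).
  apply: mean_le_sum => k _.
  by apply: mean_leZ; [exact: avg_weight_ge0|exact: mean_coord_pow].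
rewrite -mulr_suml sum_avg_weight ?mul1r in h; last by [].
have yl0 x k : 0 <= y x k ^+ 2 / lam ord0 by rewrite divr_ge0 ?sqr_ge0 ?ltW.
apply: mean_le_dom h.
  apply: measurable_funX; apply: measurable_sum => k.
  apply: measurable_funM => //; apply: measurable_funM => //.
  exact: measurable_funX.
move=> x; apply/andP; split.
  apply: exprn_ge0; apply: sumr_ge0 => k _.
  by apply: mulr_ge0 => //; exact: avg_weight_ge0.
apply: jensen_pow => [k|k|]; [exact: avg_weight_ge0|exact: yl0|exact: sum_avg_weight].
Qed.

(** What [sum4_pow_le] gives for the [j]-th power of the last factor in [sqn_upd_dist]. *)
Definition dev_bound (kappa : R) v j x : R := 4 ^+ j *
  ((6 * kappa * lin_sq (lam ord0) v (y x)) ^+ j +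
   (6 * kappa * (y x ord0 ^+ 2 / lam ord0)) ^+ j +
   (4 * kappa ^+ 2 * lin_sq (lam ord0) v (y x) ^+ 2) ^+ j +
   (4 * kappa ^+ 2 * avg_sq (lam ord0) v (y x) ^+ 2) ^+ j).

(** With [z = 48 * kappa * j], each of the four terms has mean at most [z ^+ j]: the first two
    because [48 = 4 * 6 * 2], the last two because [4 * 4 * kappa^2 * (4 j)^2 = z^2 / 9 <= z]. *)
Lemma mean_dev_bound kappa v m : v ord0 = 1 -> 0 <= kappa ->
  48 * kappa * m.+1%:R <= 1 ->
  mean_le mu (dev_bound kappa v m.+1) (4 * (48 * kappa * m.+1%:R) ^+ m.+1).
Proof.
move=> v1 k0 k1; set j := m.+1.
have dbl : (2 * j)%N = (2 * m.+1).-1.+1 by rewrite prednK// muln_gt0.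
have p1 : 0 <= (6 * kappa) ^+ j by rewrite exprn_ge0// mulr_ge0.
have p2 : 0 <= (4 * kappa ^+ 2) ^+ j by rewrite exprn_ge0// mulr_ge0 ?sqr_ge0.
have p4 : 0 <= (4 : R) ^+ j by rewrite exprn_ge0.
have q1 := mean_leZ p1 (mean_lin_sq_pow m v1).
have q2 := mean_leZ p1 (mean_coord_pow ord0 m).
have q3 := mean_leZ p2 (mean_lin_sq_pow (2 * m.+1).-1 v1).
have q4 := mean_leZ p2 (mean_avg_sq_pow v (2 * m.+1).-1).
rewrite -!dbl in q3 q4.
have h := mean_leZ p4 (mean_leD (mean_leD (mean_leD q1 q2) q3) q4).
apply: (mean_le_trans (eq_mean_le _ h)).
  move=> x; rewrite /dev_bound /=.
  move: (lin_sq _ _ _) (_ / _) (avg_sq _ _ _) => s w r.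
  by rewrite -/j !(exprMn j (6 * kappa)) !(exprMn j (4 * kappa ^+ 2)) !(exprM _ 2).
have z0 : 0 <= 48 * kappa * j%:R by rewrite !mulr_ge0.
rewrite -/j; set z := 48 * kappa * j%:R in z0 k1 *.
have e1 : 4 ^+ j * ((6 * kappa) ^+ j * (2 * j)%:R ^+ j) = z ^+ j.
  by rewrite -!exprMn natrM; congr (_ ^+ _); rewrite /z; ring.
have e2 : 4 ^+ j * ((4 * kappa ^+ 2) ^+ j * (2 * (2 * j))%:R ^+ (2 * j)) <= z ^+ j.
  rewrite exprM -!exprMn lerXn2r ?nnegrE//.
    by rewrite !mulr_ge0 ?sqr_ge0.
  have -> : 4 * (4 * kappa ^+ 2 * (2 * (2 * j))%:R ^+ 2) = z ^+ 2 / 9.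
    by rewrite !natrM /z; field.
  nra.
by rewrite !mulrDr e1; lra.
Qed.

End moments.

(** * Drift of a high power of the squared norm *)

Lemma geom_half_le (R : realType) (u : R) m : 0 <= u -> u <= 1 / 2 ->
  \sum_(i < m) u ^+ i <= 2.
Proof.
move=> u0 u2; suff : \sum_(i < m) u ^+ i + 2 * u ^+ m <= 2.
  by have := exprn_ge0 m u0; lra.
elim: m => [|m ih]; first by rewrite big_ord0 expr0; lra.
rewrite big_ord_recr/= exprS; have := exprn_ge0 m u0 => um.
have := ler_wpM2r um u2; lra.
Qed.

Section potential.
Context (R : realType) (dE : measure_display) (E : measurableType dE)
  (mu : probability E R) (n : nat) (lam : 'I_n.+1 -> R)
  (y : E -> 'I_n.+1 -> R).
Implicit Types a b v : 'I_n.+1 -> R.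
Hypotheses (lam_ge0 : forall k, 0 <= lam k)
  (lam_le : forall k, lam k <= lam ord0) (l_gt0 : 0 < lam ord0)
  (my : forall k, measurable_fun setT (fun x => y x k))
  (y_cov : forall j k, has_mean mu (fun x => y x j * y x k) ((j == k)%:R * lam k))
  (y_moment : forall a m, mean_le mu (fun x => lin a (y x) ^+ (2 * m.+1))
     ((2 * m.+1)%:R ^+ m.+1 * spec_form lam a ^+ m.+1)).
Variables (beta L L0 : R) (p : nat).
Let kappa := beta * lam ord0 * Num.sqrt L.
Hypotheses (beta_ge0 : 0 <= beta) (dL0 : n.+1%:R <= L0)
  (kp : 192 * kappa * p.+1%:R <= 1 / 2).

Let kappa_ge0 : 0 <= kappa.
Proof. by rewrite /kappa !mulr_ge0// ?sqrtr_ge0// ltW. Qed.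

Lemma pow_binomial_le (G D : R) (b : nat -> R) : 0 <= G ->
  (forall j, `|D| ^+ j <= G ^+ j * b j) ->
  (G + D) ^+ p.+1 <= G ^+ p.+1 + (p.+1%:R * G ^+ p * D +
    \sum_(i < p) 'C(p.+1, i.+2)%:R * G ^+ p.+1 * b i.+2).
Proof.
move=> G0 Db; rewrite exprDn big_ord_recl big_ord_recl/=.
rewrite subn0 expr0 mulr1 bin0 mulr1n lerD2l subSS subn0 expr1 bin1.
rewrite -mulr_natl mulrA lerD2l; apply: ler_sum => i _.
rewrite /bump/= !add1n -mulr_natl -mulrA ler_wpM2l//.
have -> : p.+1 = (p.+1 - i.+2 + i.+2)%N by rewrite subnK// ltnS.
rewrite addnK exprD -mulrA ler_wpM2l ?exprn_ge0//.
by apply: le_trans (Db i.+2); rewrite -normrX ler_norm.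
Qed.

(* Only the first-order term of the binomial expansion keeps its sign, which
   provides the negative drift; the others are bounded in absolute value. *)
Definition potential_bound v x : R :=
  (sqn v + L0) ^+ p.+1 + (p.+1%:R * (sqn v + L0) ^+ p * sqn_incr beta v (y x) +
    \sum_(i < p) 'C(p.+1, i.+2)%:R * (sqn v + L0) ^+ p.+1 * dev_bound lam y kappa v i.+2 x).

Lemma potential_le v x : v ord0 = 1 -> sqn v <= L ->
  (sqn (upd beta v (y x)) + L0) ^+ p.+1 <= potential_bound v x.
Proof.
move=> v1 vL; have W0 := sqn_ge0 v.
have L00 : 0 <= L0 by apply: le_trans dL0.
have G0 : 0 <= sqn v + L0 by exact: addr_ge0.
set D := sqn (upd beta v (y x)) - sqn v.
have -> : sqn (upd beta v (y x)) + L0 = sqn v + L0 + D by rewrite /D; ring.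
apply: (le_trans (pow_binomial_le (b := fun j => dev_bound lam y kappa v j x) G0 _)).
  move=> j; rewrite /dev_bound.
  have := @sqn_upd_dist _ _ beta _ L L0 v (y x) beta_ge0 l_gt0 v1 vL dL0.
  rewrite -/D -/kappa => hD.
  have s0 : 0 <= lin_sq (lam ord0) v (y x).
    by rewrite divr_ge0 ?sqr_ge0// mulr_ge0// ltW.
  have w0 : 0 <= y x ord0 ^+ 2 / lam ord0 by rewrite divr_ge0 ?sqr_ge0// ltW.
  have k6 : 0 <= 6 * kappa by rewrite mulr_ge0.
  have k4 : 0 <= 4 * kappa ^+ 2 by rewrite mulr_ge0 ?sqr_ge0.
  have h4 := @sum4_pow_le _ _ _ _ _ j (mulr_ge0 k6 s0) (mulr_ge0 k6 w0)
    (mulr_ge0 k4 (sqr_ge0 (lin_sq (lam ord0) v (y x))))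
    (mulr_ge0 k4 (sqr_ge0 (avg_sq (lam ord0) v (y x)))).
  apply: (le_trans _ (ler_wpM2l (exprn_ge0 j G0) h4)).
  rewrite -exprMn; apply: lerXn2r; rewrite ?nnegrE//.
  by apply: mulr_ge0 => //; rewrite !addr_ge0// mulr_ge0// sqr_ge0.
rewrite /potential_bound lerD2l lerD2r ler_wpM2l//.
  by rewrite mulr_ge0// exprn_ge0.
by rewrite lerBlDl; exact: sqn_upd_le.
Qed.

(** By [binomial_expnn_le] the term of order [j >= 2] is at most [4 * u ^+ j] relative to the
    potential, with [u = 192 * kappa * p.+1 <= 1 / 2]; the geometric series then sums to at most
    [8 * u ^+ 2]. *)
Lemma mean_potential v c : v ord0 = 1 ->
  mean_le mu (fun x => sqn_incr beta v (y x)) c ->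
  mean_le mu (potential_bound v) ((sqn v + L0) ^+ p.+1 +
    (p.+1%:R * (sqn v + L0) ^+ p * c +
     8 * (192 * kappa * p.+1%:R) ^+ 2 * (sqn v + L0) ^+ p.+1)).
Proof.
move=> v1 hc; set G := sqn v + L0; set u := 192 * kappa * p.+1%:R.
have u2 : u <= 1 / 2 by exact: kp.
have u0 : 0 <= u by rewrite /u !mulr_ge0.
have G0 : 0 <= G by rewrite addr_ge0 ?sqn_ge0//; apply: le_trans dL0.
have h3 : mean_le mu (fun x => \sum_(i < p) 'C(p.+1, i.+2)%:R * G ^+ p.+1 *
    dev_bound lam y kappa v i.+2 x)
    (\sum_(i < p) G ^+ p.+1 * (4 * u ^+ 2) * u ^+ i).
  apply: mean_le_sum => i _.
  have ip : (i.+2 <= p.+1)%N by rewrite ltnS.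
  have hk : 48 * kappa * i.+2%:R <= 1.
    apply: (@le_trans _ _ (48 * kappa * p.+1%:R)).
      by rewrite ler_wpM2l ?mulr_ge0// ler_nat.
    have : 0 <= kappa * p.+1%:R by rewrite mulr_ge0.
    by move: u2; rewrite /u; lra.
  have c0 : 0 <= 'C(p.+1, i.+2)%:R * G ^+ p.+1 by rewrite mulr_ge0// exprn_ge0.
  apply: mean_le_trans (mean_leZ c0 (mean_dev_bound lam_ge0 lam_le l_gt0 my y_moment v1 kappa_ge0 hk)) _.
  set X := (48 * kappa * i.+2%:R) ^+ i.+2.
  have -> : G ^+ p.+1 * (4 * u ^+ 2) * u ^+ i = G ^+ p.+1 * 4 * u ^+ i.+2.
    by rewrite -[i.+2]add2n exprD; ring.
  have -> : 'C(p.+1, i.+2)%:R * G ^+ p.+1 * (4 * X) = G ^+ p.+1 * 4 * ('C(p.+1, i.+2)%:R * X).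
    by ring.
  apply: ler_wpM2l; first by rewrite mulr_ge0// exprn_ge0.
  rewrite /X exprMn.
  have -> : u ^+ i.+2 = (48 * kappa) ^+ i.+2 * (4 * p.+1)%:R ^+ i.+2.
    by rewrite -exprMn natrM /u; congr (_ ^+ _); ring.
  rewrite mulrCA ler_wpM2l ?exprn_ge0 ?mulr_ge0//.
  by rewrite -!natrX -natrM ler_nat binomial_expnn_le.
have c1 : 0 <= p.+1%:R * G ^+ p by rewrite mulr_ge0// exprn_ge0.
have h := mean_leD (has_mean_le (mean_cst mu (G ^+ p.+1))) (mean_leD (mean_leZ c1 hc) h3).
apply: mean_le_trans h _; rewrite !lerD2l -mulr_sumr.
have := geom_half_le p u0 u2 => gh.
have cu : 0 <= G ^+ p.+1 * (4 * u ^+ 2).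
  by apply: mulr_ge0; [exact: exprn_ge0|apply: mulr_ge0 => //; exact: sqr_ge0].
have := ler_wpM2l cu gh; lra.
Qed.

End potential.

(** * The truncated chain *)

Lemma measurable_clip_inv (R : realType) : measurable_fun setT (@clip_inv R).
Proof.
(* The reciprocal becomes a real power, known to be measurable; the two agree here since
   [1 + x > 0]. *)
have -> : @clip_inv R = fun x => if `|x| <= 1 / 2 then (1 + x) `^ (-1) else 1.
  apply/funext => x; rewrite /clip_inv; case: ifPn => // /ler_normlP[x1 x2].
  by rewrite powR_inv1//; lra.
apply: measurable_fun_ifT => //.
  by apply: measurable_fun_ler => //; exact: normr_measurable.
by apply: (measurableT_comp (measurable_powR _)); apply: measurable_funD.
Qed.

Lemma ge0_mean_le (R : realType) d (T : measurableType d) (P : probability T R)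
    (f : T -> R) c : measurable_fun setT f -> (forall x, 0 <= f x) ->
  (\int[P]_x (f x)%:E <= c%:E)%E -> mean_le P f c.
Proof.
move=> mf f0 fc; have i_f : P.-integrable setT (EFin \o f).
  apply/integrableP; split; first exact/measurable_EFinP.
  under eq_integral do rewrite /= ger0_norm//.
  exact: le_lt_trans fc (ltry _).
split => //; rewrite -lee_fin.
by rewrite fineK//; exact: integrable_fin_num.
Qed.

Lemma mean_le_integral (R : realType) d (T : measurableType d) (P : probability T R)
    (f : T -> R) c : mean_le P f c -> (\int[P]_x (f x)%:E <= c%:E)%E.
Proof.
by move=> [i_f fc]; rewrite -[leLHS]fineK ?lee_fin//; exact: integrable_fin_num.
Qed.

Lemma markov_mean_le (R : realType) d (T : measurableType d) (P : probability T R)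
    (f : T -> R) c (A : set T) : measurable A -> (forall x, 0 <= f x) ->
  (forall x, A x -> 1 <= f x) -> mean_le P f c -> (P A <= c%:E)%E.
Proof.
move=> mA f0 Af fc; rewrite -[A]setIT -integral_indic//.
apply: (ge0_integral_mean_le _ _ fc); first exact: measurable_indic.
move=> x; rewrite indicE; case: (boolP (x \in A)) => xA /=.
  by rewrite ler01 Af//; rewrite inE in xA.
by rewrite lexx f0.
Qed.

Section chain_mean.
Context (R : realType) (dV dE dP : measure_display) (V : measurableType dV)
  (E : measurableType dE) (Omega : measurableType dP)
  (P : probability Omega R) (X : nat -> {RV P >-> E}) (mu : probability E R)
  (Phi : V * E -> V) (v0 : V).
Hypotheses (Xindep : mutually_independent X)
  (Xmu : forall n A, measurable A -> P (X n @^-1` A) = mu A)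
  (mPhi : measurable_fun [set: V * E] Phi).

Let vn n w := chain Phi v0 (fun k => X k w) n.

(** Turns a one-step bound given the state into an unconditional one. The former is required only at
    states visited by the chain, because the step estimates assume first coordinate 1. *)
Lemma mean_chain_pair n (F : V * E -> R) (h : V -> R) c :
  measurable_fun [set: V * E] F -> (forall z, 0 <= F z) ->
  (forall w, mean_le mu (fun x => F (vn n w, x)) (h (vn n w))) ->
  mean_le P (fun w => h (vn n w)) c ->
  mean_le P (fun w => F (vn n w, X n w)) c.
Proof.
move=> mF F0 Fh hc.
have mv : measurable_fun setT (vn n) by exact: measurable_chain.
apply: ge0_mean_le => //.
  apply: (measurableT_comp mF); apply/measurable_fun_pairP; split => //.
have := @ge0_integral_chain _ _ _ _ _ _ _ P X mu Phi v0 Xindep Xmu mPhi n (EFin \o F).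
move=> -> //; last by apply/measurable_EFinP.
apply: le_trans (mean_le_integral hc).
apply: ge0_le_integral => //.
- by move=> w _; apply: integral_ge0 => x _; rewrite lee_fin.
- apply: (measurableT_comp (f := fun v => (\int[mu]_x (F (v, x))%:E)%E)) => //.
  apply: (@measurable_fun_fubini_tonelli_F _ _ _ _ _ mu (EFin \o F)) => //.
  exact/measurable_EFinP.
- by have [/integrableP[]] := hc.
- by move=> w _; exact: mean_le_integral (Fh w).
Qed.

Lemma mean_chain_step n (F : V -> R) (h : V -> R) c :
  measurable_fun setT F -> (forall z, 0 <= F z) ->
  (forall w, mean_le mu (fun x => F (Phi (vn n w, x))) (h (vn n w))) ->
  mean_le P (fun w => h (vn n w)) c ->
  mean_le P (fun w => F (vn n.+1 w)) c.
Proof.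
move=> mF F0 Fh hc; apply: (@mean_chain_pair n (F \o Phi) h) => //.
  exact: measurableT_comp.
by move=> z; exact: F0.
Qed.

End chain_mean.

Section ratio_step.
Context (R : realType) (n : nat) (dE : measure_display) (E : measurableType dE)
  (y : E -> 'I_n.+1 -> R) (beta L : R).
Hypothesis my : forall k, measurable_fun setT (fun x => y x k).

Let V := (n.+1.-tuple R)%type.

(* Restarting from the top eigenvector when sqn exceeds L makes the moment
   recursions below hold without conditioning. *)
Definition ratio_step (vx : V * E) : V :=
  [tuple if sqn (tnth vx.1) <= L then upd beta (tnth vx.1) (y vx.2) k
         else (k == ord0)%:R | k < n.+1].

Lemma tnth_ratio_step v x k : tnth (ratio_step (v, x)) k =
  if sqn (tnth v) <= L then upd beta (tnth v) (y x) k else (k == ord0)%:R.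
Proof. by rewrite tnth_mktuple. Qed.

Lemma ratio_step_ord0 v x : tnth v ord0 = 1 -> tnth (ratio_step (v, x)) ord0 = 1.
Proof.
by move=> v1; rewrite tnth_ratio_step upd_ord0// eqxx; case: ifP.
Qed.

Lemma measurable_sqn : measurable_fun setT (fun v : V => sqn (tnth v)).
Proof.
apply: measurable_sum => k; apply: measurable_funX.
exact: measurable_tnth.
Qed.

Lemma measurable_tnth1 k : measurable_fun [set: V * E] (fun vx => tnth vx.1 k).
Proof. by apply: (measurableT_comp (measurable_tnth k)). Qed.

Lemma measurable_coord2 k : measurable_fun [set: V * E] (fun vx => y vx.2 k).
Proof. by apply: (measurableT_comp (my k)). Qed.

Lemma measurable_lin2 : measurable_fun [set: V * E] (fun vx => lin (tnth vx.1) (y vx.2)).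
Proof.
apply: measurable_sum => k; apply: measurable_funM.
  exact: measurable_tnth1.
exact: measurable_coord2.
Qed.

Definition clip_arg (vx : V * E) := beta * y vx.2 ord0 * lin (tnth vx.1) (y vx.2).

Lemma measurable_clip_arg : measurable_fun [set: V * E] clip_arg.
Proof.
apply: measurable_funM; last exact: measurable_lin2.
by apply: measurable_funM => //; exact: measurable_coord2.
Qed.

Lemma measurable_ratio_step : measurable_fun [set: V * E] ratio_step.
Proof.
apply/measurable_fun_tnthP => k.
have -> : (@tnth n.+1 R ^~ k \o ratio_step) = fun vx : V * E =>
    if sqn (tnth vx.1) <= L then upd beta (tnth vx.1) (y vx.2) k else (k == ord0)%:R.
  by apply/funext => -[v x]; rewrite /= tnth_ratio_step.
apply: measurable_fun_ifT => //.
  apply: measurable_fun_ler => //.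
  exact: (measurableT_comp measurable_sqn measurable_fst).
apply: measurable_funD; first exact: measurable_tnth1.
apply: measurable_funM; last first.
  exact: (measurableT_comp (@measurable_clip_inv R) measurable_clip_arg).
apply: measurable_funM.
  by apply: measurable_funM => //; exact: measurable_lin2.
apply: measurable_funB; first exact: measurable_coord2.
by apply: measurable_funM; [exact: measurable_tnth1|exact: measurable_coord2].
Qed.

End ratio_step.

(** * Moment recursions and failure probability of the chain with restarts *)

Section truncated_chain.
Context (R : realType) (dE : measure_display) (E : measurableType dE)
  (mu : probability E R) (n : nat) (lam : 'I_n.+1 -> R)
  (y : E -> 'I_n.+1 -> R).
Hypotheses (lam_ge0 : forall k, 0 <= lam k)
  (lam_le : forall k, lam k <= lam ord0) (l_gt0 : 0 < lam ord0)
  (my : forall k, measurable_fun setT (fun x => y x k))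
  (y_cov : forall j k, has_mean mu (fun x => y x j * y x k) ((j == k)%:R * lam k))
  (y_moment : forall a m, mean_le mu (fun x => lin a (y x) ^+ (2 * m.+1))
     ((2 * m.+1)%:R ^+ m.+1 * spec_form lam a ^+ m.+1)).
Context (dP : measure_display) (Omega : measurableType dP)
  (P : probability Omega R) (X : nat -> {RV P >-> E}).
Hypotheses (Xindep : mutually_independent X)
  (Xmu : forall m A, measurable A -> P (X m @^-1` A) = mu A).
Variables (v0 : n.+1.-tuple R) (beta g r L0 : R) (p : nat).
Hypotheses (v01 : tnth v0 ord0 = 1) (v0L : sqn (tnth v0) <= 1 + L0)
  (beta_gt0 : 0 < beta) (g_gt0 : 0 < g) (g_le : g <= r)
  (bl_le : beta * lam ord0 <= r) (bl_sqr : (beta * lam ord0) ^+ 2 = g * r)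
  (g_gap : forall k, k != ord0 -> g <= beta * (lam ord0 - lam k))
  (n_gt0 : (0 < n)%N) (dL0 : n.+1%:R <= L0)
  (small : r * L0 * p.+1%:R <= 2 / 10 ^+ 9).

(** Leaving the region means [sqn + L0 > 8 * L0], while the moments of [sqn + L0] stay of order
    [(5/2 * L0) ^+ p.+1]. The ratio 5/16 is below 1/3, the base in the failure probability. *)
Let L := 7 * L0.
Let kappa := beta * lam ord0 * Num.sqrt L.
Let Phi := @ratio_step R n dE E y beta L.
Let vn m w := tnth (chain Phi v0 (fun k => X k w) m).
Let tail (v : 'I_n.+1 -> R) := \sum_(k < n) v (lift ord0 k) ^+ 2.

Let L02 : 2 <= L0.
Proof. by apply: le_trans dL0; rewrite ler_nat ltnS. Qed.

Let r_gt0 : 0 < r. Proof. exact: lt_le_trans g_le. Qed.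

Let rp_le : r * p.+1%:R <= 1 / 10 ^+ 9.
Proof.
have : 0 <= r * p.+1%:R by rewrite mulr_ge0// ltW.
move=> h; have := ler_wpM2l h L02; have := small.
have -> : r * L0 * p.+1%:R = r * p.+1%:R * L0 by ring.
lra.
Qed.

Let rL0_le : r * L0 <= 2 / 10 ^+ 9.
Proof.
have r0 := r_gt0; have L2 := L02.
have h : 0 <= r * L0 by apply: mulr_ge0; lra.
have p1 : 1 <= p.+1%:R :> R by rewrite ler1n.
by have := ler_wpM2l h p1; have := small; lra.
Qed.

Let r_le : r <= 1 / 10 ^+ 9.
Proof.
have p1 : 1 <= p.+1%:R :> R by rewrite ler1n.
by have := ler_wpM2l (ltW r_gt0) p1; have := rp_le; lra.
Qed.

Let L_ge0 : 0 <= L. Proof. by rewrite /L; have := L02; lra. Qed.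

Let kappa_ge0 : 0 <= kappa.
Proof. by rewrite /kappa !mulr_ge0// ?sqrtr_ge0// ltW. Qed.

(** From [(beta * lam ord0)^2 = g * r] one factor [p.+1 * g] splits off, and what remains is 7 times
    the small quantity [r * L0 * p.+1]. Thus the second-order terms of the expansion stay far below
    the drift [p.+1 * g]. *)
Let kappa_sqr : (kappa * p.+1%:R) ^+ 2 <= 14 / 10 ^+ 9 * (p.+1%:R * g).
Proof.
have -> : (kappa * p.+1%:R) ^+ 2 = 7 * (p.+1%:R * g) * (r * L0 * p.+1%:R).
  rewrite /kappa !exprMn sqr_sqrtr// -exprMn bl_sqr /L; ring.
have h : 0 <= 7 * (p.+1%:R * g) by rewrite !mulr_ge0// ltW.
by have := ler_wpM2l h small; lra.
Qed.

Let pg_le : p.+1%:R * g <= 1 / 10 ^+ 9.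
Proof. by apply: le_trans rp_le; rewrite mulrC ler_wpM2r. Qed.

Let kp : 192 * kappa * p.+1%:R <= 1 / 2.
Proof.
have k0 : 0 <= kappa * p.+1%:R by rewrite mulr_ge0.
have : (kappa * p.+1%:R) ^+ 2 <= (1 / 384) ^+ 2.
  by apply: (le_trans kappa_sqr); have := pg_le; lra.
rewrite ler_sqr ?nnegrE; last 2 first.
- exact: k0.
- by apply: divr_ge0; [exact: ler01|exact: ler0n].
lra.
Qed.

Let mPhi : measurable_fun [set: n.+1.-tuple R * E] Phi.
Proof. exact: measurable_ratio_step. Qed.

Let vn0 m w : vn m w ord0 = 1.
Proof. by elim: m => [|m ih] //=; exact: ratio_step_ord0. Qed.

Let tailE v : v ord0 = 1 -> sqn v = 1 + tail v.
Proof. by move=> v1; rewrite sqnE v1 expr1n. Qed.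

Let tail_ge0 v : 0 <= tail v.
Proof. by apply: sumr_ge0 => k _; exact: sqr_ge0. Qed.

Let measurable_Phi1 v : measurable_fun setT (fun x => Phi (v, x)).
Proof.
apply: (measurableT_comp mPhi); apply/measurable_fun_pairP.
by split; [exact: measurable_cst|exact: measurable_id].
Qed.

Let measurable_Phi_coord v k : measurable_fun setT (fun x => tnth (Phi (v, x)) k).
Proof. exact: (measurableT_comp (measurable_tnth k) (measurable_Phi1 v)). Qed.

Let a k := beta * (lam ord0 - lam k).

Let a_le k : a k <= 1 / 10 ^+ 9.
Proof.
apply: le_trans r_le; apply: le_trans bl_le; apply: ler_wpM2l; first exact: ltW.
by rewrite lerBlDr lerDl.
Qed.

Let coord_bound (v : 'I_n.+1 -> R) k :=
  (1 - 7 / 4 * a k) * v k ^+ 2 + 192 * beta ^+ 2 * lam ord0 * lam k * (1 + tail v).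

Let coord_bound_ge0 v k : 0 <= coord_bound v k.
Proof.
have ak := a_le k; have t0 := tail_ge0 v; have b0 := beta_gt0.
apply: addr_ge0; apply: mulr_ge0; [by lra|exact: sqr_ge0| |by lra].
apply: mulr_ge0; last exact: lam_ge0.
by apply: mulr_ge0; [apply: mulr_ge0; [exact: ler0n|exact: sqr_ge0]|exact: ltW].
Qed.

(** Of the exact drift [2 * a k], a quarter of [a k] pays for the noise [224 * (beta * lam ord0)^2 *
    sqn v * v_k^2], which is small because [sqn v <= L] unless the chain restarts. *)
Let mean_coord_step v k : tnth v ord0 = 1 -> k != ord0 ->
  mean_le mu (fun x => tnth (Phi (v, x)) k ^+ 2) (coord_bound (tnth v) k).
Proof.
move=> v1 k0; have [vL|vL] := leP (sqn (tnth v)) L; last first.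
  (* A restart sets this coordinate to 0, so any nonnegative bound holds. *)
  apply: (@mean_le_trans _ _ _ _ _ 0); last exact: coord_bound_ge0.
  apply: (eq_mean_le _ (has_mean_le (mean_cst mu 0))) => x.
  by rewrite tnth_ratio_step leNgt vL/= (negbTE k0) expr0n.
have h := mean_upd_sqr lam_ge0 lam_le my y_cov y_moment beta k v1.
have h2 := mean_leD (has_mean_le (mean_cst mu (tnth v k ^+ 2))) h.
apply: (mean_le_trans (mean_le_dom _ _ h2)); first by apply: measurable_funX.
  move=> x; rewrite sqr_ge0/= tnth_ratio_step vL.
  by apply: upd_sqr_le; exact: ltW.
rewrite /coord_bound -tailE//.
have hL : beta ^+ 2 * lam ord0 * sqn (tnth v) * lam ord0 <= 7 * (2 / 10 ^+ 9) * g.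
  have -> : beta ^+ 2 * lam ord0 * sqn (tnth v) * lam ord0 = g * r * sqn (tnth v).
    by rewrite -bl_sqr; ring.
  have gr0 : 0 <= g * r by rewrite mulr_ge0// ltW.
  apply: le_trans (ler_wpM2l gr0 vL) _.
  have := ler_wpM2l (ltW g_gt0) rL0_le; rewrite /L; lra.
have gk := g_gap k0; rewrite -/(a k) in gk.
have hk : 224 * (beta ^+ 2 * lam ord0 * sqn (tnth v) * lam ord0) <= 1 / 4 * a k.
  by have := ltW g_gt0; lra.
have := ler_wpM2r (sqr_ge0 (tnth v k)) hk.
rewrite /a; lra.
Qed.

Let grL0 : g * (r * L0) = beta ^+ 2 * lam ord0 ^+ 2 * L0.
Proof. by rewrite mulrA -bl_sqr exprMn. Qed.

Let sum_lam_le : \sum_(k < n) lam (lift ord0 k) <= lam ord0 * L0.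
Proof.
apply: (@le_trans _ _ (\sum_(k < n) lam ord0)); first exact: ler_sum.
rewrite sumr_const card_ord -mulr_natr ler_wpM2l// ?(ltW l_gt0)//.
by apply: le_trans dL0; rewrite ler_nat.
Qed.

Let sum_a_ge (v : 'I_n.+1 -> R) :
  g * tail v <= \sum_(k < n) a (lift ord0 k) * v (lift ord0 k) ^+ 2.
Proof.
rewrite /tail mulr_sumr; apply: ler_sum => k _.
by rewrite ler_wpM2r ?sqr_ge0// g_gap.
Qed.

(** The noise summed over the coordinates is at most [192 * g * (r * L0) * (1 + T) <= g / 4 * (1 +
    T)]: the rate drops from 7/4 to 3/2 and the constant [g / 4] remains. *)
Let tail_bound (v : 'I_n.+1 -> R) := (1 - 3 / 2 * g) * tail v + 1 / 4 * g.

Let mean_tail_step v : tnth v ord0 = 1 ->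
  mean_le mu (fun x => tail (tnth (Phi (v, x)))) (tail_bound (tnth v)).
Proof.
move=> v1.
have h : mean_le mu (fun x => tail (tnth (Phi (v, x))))
    (\sum_(k < n) coord_bound (tnth v) (lift ord0 k)).
  by apply: mean_le_sum => k _; apply: mean_coord_step.
apply: mean_le_trans h _; rewrite /coord_bound /tail_bound big_split/=.
rewrite -mulr_suml -mulr_sumr.
have -> : \sum_(k < n) (1 - 7 / 4 * a (lift ord0 k)) * tnth v (lift ord0 k) ^+ 2 =
   tail (tnth v) - 7 / 4 * (\sum_(k < n) a (lift ord0 k) * tnth v (lift ord0 k) ^+ 2).
  by rewrite mulr_sumr -sumrB; apply: eq_bigr => k _; ring.
have s1 := sum_a_ge (tnth v); have t0 := tail_ge0 (tnth v).
set T := tail (tnth v) in s1 t0 *.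
have s2 : 192 * beta ^+ 2 * lam ord0 * \sum_(k < n) lam (lift ord0 k) <= 1 / 4 * g.
  have c0 : 0 <= 192 * beta ^+ 2 * lam ord0.
    by apply: mulr_ge0; [apply: mulr_ge0; [exact: ler0n|exact: sqr_ge0]|exact: ltW].
  apply: le_trans (ler_wpM2l c0 sum_lam_le) _.
  have -> : 192 * beta ^+ 2 * lam ord0 * (lam ord0 * L0) = 192 * (g * (r * L0)).
    by rewrite grL0; ring.
  by have := ler_wpM2l (ltW g_gt0) rL0_le; have := g_gt0; lra.
have T1 : 0 <= 1 + T by lra.
have := ler_wpM2r T1 s2; lra.
Qed.

Let Y := (5 / 2 * L0) ^+ p.+1.

Let potential (v : 'I_n.+1 -> R) := (sqn v + L0) ^+ p.+1.

(** The rate 2/5 is a lower bound for [3/2 - 1 - 1/20]: the drift, less the share of the constant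
    term absorbed by the potential, less the second-order terms. *)
Let potential_next (v : 'I_n.+1 -> R) :=
  (1 - 2 / 5 * (p.+1%:R * g)) * potential v + p.+1%:R * g * Y.

Let L0_ge0 : 0 <= L0. Proof. by have := L02; lra. Qed.

Let pg_gt0 : 0 < p.+1%:R * g. Proof. by rewrite mulr_gt0. Qed.

Let sqn_incr_mean v : tnth v ord0 = 1 -> sqn (tnth v) <= L ->
  mean_le mu (fun x => sqn_incr beta (tnth v) (y x))
    (g * (- (3 / 2) * tail (tnth v) + 1 / 4)).
Proof.
move=> v1 vL; apply: mean_le_trans (mean_sqn_incr lam_ge0 lam_le my y_cov y_moment beta v1) _.
rewrite big_split/= -mulr_sumr big_split/= -!mulr_sumr -/(sqn _).
have -> : \sum_k (- 2 * beta * (lam ord0 - lam k) * tnth v k ^+ 2) =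
    - 2 * \sum_(k < n) a (lift ord0 k) * tnth v (lift ord0 k) ^+ 2.
  rewrite big_ord_recl subrr mulr0 mul0r add0r mulr_sumr.
  by apply: eq_bigr => k _; rewrite /a; ring.
have s1 := sum_a_ge (tnth v); have t0 := tail_ge0 (tnth v).
have sl : \sum_k lam k <= lam ord0 * L0.
  apply: (@le_trans _ _ (\sum_(k < n.+1) lam ord0)); first exact: ler_sum.
  by rewrite sumr_const card_ord -mulr_natr ler_wpM2l// (ltW l_gt0).
have WE := tailE v1; set W := sqn (tnth v) in vL WE *.
set T := tail (tnth v) in s1 t0 WE *.
have W0 : 0 <= W by rewrite WE; lra.
have c0 : 0 <= beta ^+ 2 * lam ord0 * W.
  by rewrite mulr_ge0// mulr_ge0 ?sqr_ge0// ltW.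
(* [1760 = 192 + 224 * 7], the 7 coming from [W <= L]; the premise left open is [s4]. *)
have s2 := ler_wpM2l c0 (_ : 192 * \sum_k lam k + 224 * lam ord0 * W <= 1760 * (lam ord0 * L0)).
have s3 : beta ^+ 2 * lam ord0 * W * (1760 * (lam ord0 * L0)) <= g * (1 / 4 * W).
  have -> : beta ^+ 2 * lam ord0 * W * (1760 * (lam ord0 * L0)) = 1760 * W * (g * (r * L0)).
    by rewrite grL0; ring.
  have h := ler_wpM2l (ltW g_gt0) rL0_le.
  have W17 : 0 <= 1760 * W by lra.
  have gW : 0 <= g * W by rewrite mulr_ge0// ltW.
  by have := ler_wpM2l W17 h; lra.
have s4 : 192 * \sum_k lam k + 224 * lam ord0 * W <= 1760 * (lam ord0 * L0).
  by have := ler_wpM2l (ltW l_gt0) vL; rewrite /L; lra.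
have gT := mulr_ge0 (ltW g_gt0) t0.
have := s2 s4; rewrite WE in s3 *; lra.
Qed.

Let potential_step v : tnth v ord0 = 1 ->
  mean_le mu (fun x => potential (tnth (Phi (v, x)))) (potential_next (tnth v)).
Proof.
move=> v1; have L2 := L02; have pg0 := pg_gt0; have pg1 := pg_le.
have W1 : 1 <= sqn (tnth v) by exact: sqn_ge1.
have [vL|vL] := leP (sqn (tnth v)) L; last first.
  apply: (eq_mean_le (f := cst ((1 + L0) ^+ p.+1))).
    move=> x /=; rewrite /potential; congr ((_ + _) ^+ _).
    rewrite /sqn big_ord_recl big1 => [|k _]; rewrite tnth_ratio_step leNgt vL/=.
      by rewrite ?eqxx expr1n addr0.
    by rewrite expr0n.
  apply: mean_le_trans (has_mean_le (mean_cst mu _)) _.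
  rewrite /potential_next /potential.
  (* Here [sqn + L0 > 8 * L0 >= 2 * (1 + L0)], so a restart at least halves the potential, more than
     the recursion asks. *)
  have h1 : 2 * (1 + L0) ^+ p.+1 <= (sqn (tnth v) + L0) ^+ p.+1.
    apply: (@le_trans _ _ ((2 * (1 + L0)) ^+ p.+1)).
      rewrite exprMn ler_wpM2r ?exprn_ge0//; first by lra.
      by rewrite exprS ler_peMr// exprn_ege1// ler1n.
    by rewrite lerXn2r ?nnegrE//; move: vL; rewrite /L; lra.
  have Y0 : 0 <= p.+1%:R * g * Y.
    by rewrite mulr_ge0 ?(ltW pg0)// exprn_ge0//; lra.
  have P0 : 0 <= (1 + L0) ^+ p.+1 by rewrite exprn_ge0//; lra.
  have c0 : 0 <= 1 / 2 - 2 / 5 * (p.+1%:R * g) by lra.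
  have c1 : 0 <= (sqn (tnth v) + L0) ^+ p.+1 by lra.
  by have := mulr_ge0 c0 c1; lra.
have b0 := ltW beta_gt0.
have hc := sqn_incr_mean v1 vL.
have h := mean_potential lam_ge0 lam_le l_gt0 my y_moment b0 dL0 kp v1 hc.
apply: (mean_le_trans (mean_le_dom _ _ h)).
  apply: measurable_funX; apply: measurable_funD => //.
  exact: (measurableT_comp (@measurable_sqn R n) (measurable_Phi1 v)).
- move=> x; apply/andP; split.
    by rewrite exprn_ge0// addr_ge0// sqn_ge0.
  have -> : potential (tnth (Phi (v, x))) = (sqn (upd beta (tnth v) (y x)) + L0) ^+ p.+1.
    congr ((_ + _) ^+ _); apply: eq_bigr => k _.
    by rewrite tnth_ratio_step vL.
  exact: potential_le.
rewrite /potential_next /potential.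
have -> : tail (tnth v) = sqn (tnth v) - 1 by rewrite (tailE v1); ring.
set G := sqn (tnth v) + L0; have GE : sqn (tnth v) = G - L0 by rewrite /G; ring.
have G0 : 0 <= G by rewrite /G; lra.
have second : 8 * (192 * kappa * p.+1%:R) ^+ 2 <= 1 / 20 * (p.+1%:R * g).
  have -> : 8 * (192 * kappa * p.+1%:R) ^+ 2 =
    8 * 192 * 192 * (kappa * p.+1%:R) ^+ 2 by ring.
  by have := kappa_sqr; lra.
have GP0 : 0 <= G ^+ p.+1 by exact: exprn_ge0.
have q1 := ler_wpM2r GP0 second.
(* Above [G = 5/2 * L0] the left side is absorbed by the potential, below it by [Y]. *)
have q2 : 5 / 2 * L0 * G ^+ p <= G ^+ p.+1 + Y.
  have Y0 : 0 <= Y by rewrite exprn_ge0//; lra.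
  have [GL|LG] := leP (5 / 2 * L0) G.
    by have := ler_wpM2r (exprn_ge0 p G0) GL; rewrite -exprS; lra.
  have : 5 / 2 * L0 * G ^+ p <= Y.
    rewrite /Y exprS ler_wpM2l//; first by lra.
    by rewrite lerXn2r ?nnegrE ?(ltW LG)//; lra.
  lra.
(* Since [sqn = G - L0], the constant is [3/2 * L0 + 7/4], at most [5/2 * L0] as [L0 >= 2]; this is
   the 5/2 in [Y]. *)
have q3 : G ^+ p * (- (3 / 2) * (sqn (tnth v) - 1) + 1 / 4) <=
    - (3 / 2) * G ^+ p.+1 + 5 / 2 * L0 * G ^+ p.
  rewrite GE exprS; have := exprn_ge0 p G0 => Gp.
  have := mulr_ge0 Gp (_ : 0 <= L0 - 7 / 4); move=> /(_ _); lra.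
have q4 := ler_wpM2l (ltW pg0) (le_trans q3 (lerD (lexx _) q2)).
have q5 := mulr_ge0 (ltW pg0) GP0.
have -> : p.+1%:R * G ^+ p * (g * (- (3 / 2) * (sqn (tnth v) - 1) + 1 / 4)) =
  p.+1%:R * g * (G ^+ p * (- (3 / 2) * (sqn (tnth v) - 1) + 1 / 4)) by ring.
rewrite -/kappa; lra.
Qed.

(** The rate is weakened from 3/2 to 1 to leave room for the forcing in [mean_coord], where
    [7/4 * 384 - 192 = 480] must exceed 384 times this rate. *)
Let mean_tail m : mean_le P (fun w => tail (vn m w)) ((1 - g) ^+ m * L0 + 1).
Proof.
have g0 := g_gt0; have g1 := le_trans g_le r_le.
elim: m => [|m ih].
  apply: mean_le_trans (has_mean_le (mean_cst P (tail (tnth v0)))) _.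
  by have := v0L; rewrite tailE// expr0 mul1r; lra.
have q0 : 0 <= 1 - 3 / 2 * g by lra.
have h := mean_leD (mean_leZ q0 ih) (has_mean_le (mean_cst P (1 / 4 * g))).
apply: mean_le_trans (mean_chain_step (F := fun v => tail (tnth v))
  (h := fun v => tail_bound (tnth v)) Xindep Xmu mPhi _ _ _ h) _.
- by apply: measurable_sum => k; apply: measurable_funX; exact: measurable_tnth.
- by move=> v; exact: tail_ge0.
- by move=> w; apply: mean_tail_step; exact: vn0.
rewrite exprS; have q1 : 0 <= 1 - g by lra.
have qL : 0 <= (1 - g) ^+ m * L0 by rewrite mulr_ge0// exprn_ge0.
by have := mulr_ge0 (ltW g0) qL; lra.
Qed.

(* 384 beta lam_1 lam_k / (lam_1 - lam_k) (1 + (1 - g)^m L0) is a supersolution of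
   the recursion given by coord_bound and mean_tail. *)
Let mean_coord m k : k != ord0 -> mean_le P (fun w => vn m w k ^+ 2)
  ((1 - 7 / 4 * g) ^+ m * tnth v0 k ^+ 2 +
   384 * (beta * lam ord0 * lam k / (lam ord0 - lam k)) * (1 + (1 - g) ^+ m * L0)).
Proof.
move=> k0; have g0 := g_gt0; have g1 := le_trans g_le r_le.
have gk := g_gap k0; rewrite -/(a k) in gk.
have ak0 : 0 < a k by exact: lt_le_trans gk.
have gap0 : 0 < lam ord0 - lam k by move: ak0; rewrite /a pmulr_rgt0.
have b0 := beta_gt0.
set f := beta * lam ord0 * lam k / (lam ord0 - lam k).
have f0 : 0 <= f by rewrite /f divr_ge0 ?(ltW gap0)// !mulr_ge0// ?(ltW l_gt0)// ltW.
have fE : 192 * beta ^+ 2 * lam ord0 * lam k = 192 * (a k * f).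
  by rewrite /f /a; field; rewrite gt_eqF.
elim: m => [|m ih].
  apply: mean_le_trans (has_mean_le (mean_cst P (tnth v0 k ^+ 2))) _.
  rewrite !expr0 !mul1r lerDl; apply: mulr_ge0; last exact: addr_ge0.
  by apply: mulr_ge0; [exact: ler0n|exact: f0].
have ak1 := a_le k.
have c1 : 0 <= 1 - 7 / 4 * a k by lra.
have c2 : 0 <= 192 * beta ^+ 2 * lam ord0 * lam k.
  rewrite fE; apply: mulr_ge0; first exact: ler0n.
  by apply: mulr_ge0; [exact: ltW|exact: f0].
have h := mean_leD (mean_leZ c1 ih)
  (mean_leZ c2 (mean_leD (has_mean_le (mean_cst P 1)) (mean_tail m))).
apply: mean_le_trans (mean_chain_step (F := fun v => tnth v k ^+ 2)
  (h := fun v => coord_bound (tnth v) k) Xindep Xmu mPhi _ _ _ h) _.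
- by apply: measurable_funX; exact: measurable_tnth.
- by move=> v; exact: sqr_ge0.
- by move=> w; apply: mean_coord_step => //; exact: vn0.
rewrite fE (exprS (1 - 7 / 4 * g)) (exprS (1 - g)).
have q0 : 0 <= (1 - g) ^+ m * L0 by rewrite mulr_ge0// exprn_ge0//; lra.
set Q := (1 - g) ^+ m * L0 in q0 *.
have w0 : 0 <= (1 - 7 / 4 * g) ^+ m * tnth v0 k ^+ 2.
  by rewrite mulr_ge0 ?sqr_ge0// exprn_ge0//; lra.
set Z := (1 - 7 / 4 * g) ^+ m * tnth v0 k ^+ 2 in w0 *.
have -> : (1 - 7 / 4 * g) * (1 - 7 / 4 * g) ^+ m * tnth v0 k ^+ 2 = (1 - 7 / 4 * g) * Z.
  by rewrite /Z mulrA.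
have -> : (1 - g) * (1 - g) ^+ m * L0 = (1 - g) * Q by rewrite /Q mulrA.
have d1 : (1 - 7 / 4 * a k) * Z <= (1 - 7 / 4 * g) * Z by rewrite ler_wpM2r//; lra.
have d2 : 0 <= f * (a k * Q).
  by apply: mulr_ge0 => //; apply: mulr_ge0 => //; exact: ltW.
have d3 : 0 <= f * ((a k - g) * Q).
  by apply: mulr_ge0 => //; apply: mulr_ge0 => //; lra.
have d4 : 0 <= f * a k by rewrite mulr_ge0// ltW.
by lra.
Qed.

(** [5/2 * Y] is the fixed point of the recursion in [potential_next]. *)
Let mean_potential_chain m : mean_le P (fun w => potential (vn m w)) (5 / 2 * Y).
Proof.
have L2 := L02; have pg0 := pg_gt0; have pg1 := pg_le.
elim: m => [|m ih].
  apply: mean_le_trans (has_mean_le (mean_cst P (potential (tnth v0)))) _.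
  have Y0 : 0 <= Y by rewrite exprn_ge0//; lra.
  have : potential (tnth v0) <= Y.
    rewrite /potential /Y lerXn2r ?nnegrE ?addr_ge0 ?sqn_ge0//; have := v0L; lra.
  lra.
have c1 : 0 <= 1 - 2 / 5 * (p.+1%:R * g) by lra.
have h := mean_leD (mean_leZ c1 ih) (has_mean_le (mean_cst P (p.+1%:R * g * Y))).
apply: mean_le_trans (mean_chain_step (F := fun v => potential (tnth v))
  (h := fun v => potential_next (tnth v)) Xindep Xmu mPhi _ _ _ h) _.
- by apply: measurable_funX; apply: measurable_funD => //; exact: measurable_sqn.
- by move=> v; rewrite exprn_ge0// addr_ge0 ?sqn_ge0.
- by move=> w; apply: potential_step; exact: vn0.
lra.
Qed.

Let mvn m : measurable_fun setT (fun w => chain Phi v0 (fun k => X k w) m).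
Proof. exact: measurable_chain. Qed.

Let exit_set m := [set w | L < sqn (vn m w)].

Let measurable_exit_set m : measurable (exit_set m).
Proof.
rewrite -[X in measurable X]setTI.
have := @measurable_fun_ltr _ _ R setT (cst L) (fun w => sqn (vn m w)).
move=> /(_ _ _ measurableT [set true]); rewrite (_ : _ @^-1` _ = exit_set m).
  apply=> //; exact: (measurableT_comp (@measurable_sqn R n) (mvn m)).
by apply/seteqP; split => w.
Qed.

Let prob_exit_set m : (P (exit_set m) <= (5 / 2 * (1 / 3) ^+ p.+1)%:E)%E.
Proof.
have L2 := L02.
have k0 : 0 <= ((8 * L0) ^+ p.+1)^-1 by rewrite invr_ge0 exprn_ge0//; lra.
have h := mean_leZ k0 (mean_potential_chain m).
have L8 : 0 < (8 * L0) ^+ p.+1 by rewrite exprn_gt0//; lra.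
apply: le_trans (markov_mean_le (measurable_exit_set m) _ _ h) _.
- by move=> w; rewrite mulr_ge0// exprn_ge0// addr_ge0 ?sqn_ge0.
- move=> w /= wL; rewrite mulrC ler_pdivlMr// mul1r lerXn2r ?nnegrE//; first lra.
    by rewrite addr_ge0 ?sqn_ge0.
  by move: wL; rewrite /exit_set/= /L; lra.
rewrite lee_fin mulrCA ler_wpM2l// mulrC ler_pdivrMr// -exprMn.
by rewrite lerXn2r ?nnegrE//; lra.
Qed.

Let clip_event := [set vx : n.+1.-tuple R * E |
  (sqn (tnth vx.1) <= L) && (1 / 2 < `|clip_arg y beta vx|)].

Let measurable_clip_event : measurable clip_event.
Proof.
rewrite -[X in measurable X]setTI.
have h : measurable_fun [set: n.+1.-tuple R * E] (fun vx : n.+1.-tuple R * E =>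
    (sqn (tnth vx.1) <= L) && (1 / 2 < `|clip_arg y beta vx|)).
  apply: measurable_and.
    apply: measurable_fun_ler => //.
    exact: (measurableT_comp (@measurable_sqn R n) measurable_fst).
  apply: measurable_fun_ltr => //.
  by apply: measurableT_comp => //; exact: measurable_clip_arg.
have := h measurableT [set true]; rewrite (_ : _ @^-1` [set true] = clip_event).
  by apply.
by apply/seteqP; split => w.
Qed.

(** If the argument of [clip_inv] exceeds 1/2 in absolute value, AM-GM gives [kappa * (z + s) > 1]
    for the normalised squares [z] and [s]. So [dev_bound] is at least 1 there and serves in
    Markov's inequality; its mean is at most [4 * (1/8) ^+ p.+1]. *)
Let clip_prob v : tnth v ord0 = 1 ->
  mean_le mu (fun x => \1_clip_event (v, x)) (3 / 2 * (1 / 3) ^+ p.+1).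
Proof.
move=> v1; have L2 := L02; have k0 := kappa_ge0; have kp' := kp.
have k1 : 48 * kappa * p.+1%:R <= 1 / 8 by lra.
have h := mean_dev_bound lam_ge0 lam_le l_gt0 my y_moment v1 k0
  (le_trans k1 (_ : 1 / 8 <= 1)).
have {}h : mean_le mu (dev_bound lam y kappa (tnth v) p.+1)
    (3 / 2 * (1 / 3) ^+ p.+1).
  apply: mean_le_trans (h _) _; first lra.
  have h8 : (48 * kappa * p.+1%:R) ^+ p.+1 <= (1 / 8) ^+ p.+1.
    by rewrite lerXn2r ?nnegrE//; apply: mulr_ge0 => //; apply: mulr_ge0.
  have e38 : (1 / 8) ^+ p.+1 = (3 / 8) ^+ p.+1 * (1 / 3) ^+ p.+1 :> R.
    by rewrite -exprMn; congr (_ ^+ _); lra.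
  have e3 : (3 / 8) ^+ p.+1 <= 3 / 8 :> R.
    by rewrite exprS ler_piMr ?exprn_ile1//; lra.
  have e0 : 0 <= (1 / 3) ^+ p.+1 :> R by rewrite exprn_ge0.
  by have := ler_wpM2r e0 e3; lra.
apply: mean_le_dom h.
  have mi : measurable_fun setT (\1_clip_event : _ -> R) by exact: measurable_indic.
  apply: (measurableT_comp mi).
  by apply/measurable_fun_pairP; split; [exact: measurable_cst|exact: measurable_id].
move=> x; have s0 : 0 <= lin_sq (lam ord0) (tnth v) (y x).
  by rewrite divr_ge0 ?sqr_ge0// mulr_ge0 ?sqn_ge0// ltW.
have w0 : 0 <= y x ord0 ^+ 2 / lam ord0 by rewrite divr_ge0 ?sqr_ge0// ltW.
have k6 : 0 <= 6 * kappa by rewrite mulr_ge0.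
have k4 : 0 <= 4 * kappa ^+ 2 by rewrite mulr_ge0 ?sqr_ge0.
have a1 := mulr_ge0 k6 s0; have a2 := mulr_ge0 k6 w0.
have a3 := mulr_ge0 k4 (sqr_ge0 (lin_sq (lam ord0) (tnth v) (y x))).
have a4 := mulr_ge0 k4 (sqr_ge0 (avg_sq (lam ord0) (tnth v) (y x))).
have h4 := @sum4_pow_le _ _ _ _ _ p.+1 a1 a2 a3 a4.
rewrite indicE ler0n/=.
have dev0 : 0 <= dev_bound lam y kappa (tnth v) p.+1 x.
  by apply: le_trans h4; rewrite exprn_ge0// !addr_ge0.
case: (boolP ((v, x) \in clip_event)) => //=.
rewrite inE => /andP[/= vL]; rewrite /clip_arg/= => cl.
apply: le_trans h4; rewrite exprn_ege1//.
have W1 : 1 <= sqn (tnth v) by exact: sqn_ge1.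
set q := Num.sqrt L.
have kE : kappa = beta * lam ord0 * q by [].
have q2 : q ^+ 2 = L by rewrite sqr_sqrtr ?L_ge0.
have q1 : 1 <= q by rewrite -[X in X <= _]sqrtr1 ler_wsqrtr// /L; lra.
set S := lin (tnth v) (y x) in cl *; set s := lin_sq _ _ _ in s0 a1 a3 *.
set u := y x ord0 in cl w0 a2 *; set z := u ^+ 2 / lam ord0 in w0 a2 *.
have SE : S ^+ 2 = lam ord0 * sqn (tnth v) * s.
  by rewrite /s /lin_sq -/S mulrCA divff ?mulr1// mulf_neq0 ?gt_eqF//; lra.
have uE : u ^+ 2 = lam ord0 * z by rewrite /z; field; rewrite gt_eqF.
have SL : S ^+ 2 <= lam ord0 * L * s.
  by rewrite SE ler_wpM2r// ler_wpM2l// ltW.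
have key : 2 * `|u * S| <= lam ord0 * q * (z + s).
  rewrite -(ler_pM2l (_ : 0 < q)); last lra.
  have -> : q * (lam ord0 * q * (z + s)) = q ^+ 2 * (lam ord0 * z) + lam ord0 * L * s.
    by rewrite -q2; ring.
  rewrite -uE normrM; have := sqr_ge0 (q * `|u| - `|S|).
  rewrite sqrrB exprMn !real_normK ?num_real//; lra.
have b0 := ltW beta_gt0.
have : 1 < beta * (lam ord0 * q * (z + s)).
  apply: lt_le_trans (ler_wpM2l b0 key).
  by move: cl; rewrite -mulrA normrM (ger0_norm b0); lra.
have -> : beta * (lam ord0 * q * (z + s)) = kappa * z + kappa * s by rewrite kE; ring.
have kz := mulr_ge0 k0 w0; have ks := mulr_ge0 k0 s0.
lra.
Qed.

Let chain_pair m w := (chain Phi v0 (fun k => X k w) m, X m w).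

Let bad m := exit_set m `|` chain_pair m @^-1` clip_event.

Let measurable_pair_chain m : measurable_fun setT (chain_pair m).
Proof. by apply: measurable_chain_pair; exact: mPhi. Qed.

Let measurable_clip_set m : measurable (chain_pair m @^-1` clip_event).
Proof.
by rewrite -[X in measurable X]setTI; exact: measurable_pair_chain.
Qed.

Let prob_bad m : (P (bad m) <= (4 * (1 / 3) ^+ p.+1)%:E)%E.
Proof.
have h1 := prob_exit_set m.
have hc : mean_le P (fun w => \1_clip_event (chain_pair m w)) (3 / 2 * (1 / 3) ^+ p.+1).
  apply: (mean_chain_pair (F := \1_clip_event) (h := cst (3 / 2 * (1 / 3) ^+ p.+1)) Xindep Xmu mPhi).
  - exact: measurable_indic.
  - by move=> z; rewrite indicE.
  - by move=> w; apply: clip_prob; exact: vn0.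
  - exact: has_mean_le (mean_cst P _).
have h2 : (P (chain_pair m @^-1` clip_event) <= (3 / 2 * (1 / 3) ^+ p.+1)%:E)%E.
  apply: (markov_mean_le _ _ _ hc); first exact: measurable_clip_set.
    by move=> w; rewrite indicE.
  by move=> w wc; rewrite indicE mem_set.
apply: le_trans (measureU2 _ _ _) _; [exact: measurable_exit_set|exact: measurable_clip_set|].
apply: le_trans (leeD h1 h2) _.
by rewrite -EFinD lee_fin -mulrDl ler_wpM2r ?exprn_ge0//; lra.
Qed.

Lemma truncated_chain_mean m : mean_le P (fun w => \sum_(k < n) vn m w (lift ord0 k) ^+ 2)
  ((1 - 7 / 4 * g) ^+ m * L0 + 384 * (1 + (1 - g) ^+ m * L0) *
   \sum_(k < n) beta * lam ord0 * lam (lift ord0 k) / (lam ord0 - lam (lift ord0 k))).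
Proof.
have h : mean_le P (fun w => \sum_(k < n) vn m w (lift ord0 k) ^+ 2)
    (\sum_(k < n) ((1 - 7 / 4 * g) ^+ m * tnth v0 (lift ord0 k) ^+ 2 +
   384 * (beta * lam ord0 * lam (lift ord0 k) / (lam ord0 - lam (lift ord0 k))) *
     (1 + (1 - g) ^+ m * L0))).
  by apply: mean_le_sum => k _; exact: mean_coord.
apply: mean_le_trans h _; rewrite big_split/= -mulr_sumr -mulr_suml -mulr_sumr.
apply: lerD; last by rewrite le_eqVlt; apply/orP; left; apply/eqP; ring.
apply: ler_wpM2l.
  by rewrite exprn_ge0//; have := le_trans g_le r_le; lra.
have : sqn (tnth v0) <= 1 + L0 by exact: v0L.
by rewrite tailE// lerD2l.
Qed.

Lemma truncated_chain_event N : exists H : set Omega,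
  [/\ measurable H, ((1 - N%:R * (4 * (1 / 3) ^+ p.+1))%:E <= P H)%E &
    forall w m, H w -> (m < N)%N -> sqn (vn m w) <= L /\
      `|beta * y (X m w) ord0 * lin (vn m w) (y (X m w))| <= 1 / 2].
Proof.
pose B := \big[setU/set0]_(m < N) bad m.
have mbad m : measurable (bad m).
  by apply: measurableU; [exact: measurable_exit_set|exact: measurable_clip_set].
have mB : measurable B by exact: bigsetU_measurable.
have PB : (P B <= (N%:R * (4 * (1 / 3) ^+ p.+1))%:E)%E.
  apply: le_trans (Boole_inequality P _) _ => //.
  apply: (@le_trans _ _ (\sum_(i < N) (4 * (1 / 3) ^+ p.+1)%:E)%E).
    by apply: lee_sum => i _; exact: prob_bad.
  by rewrite sumEFin sumr_const card_ord lee_fin [leRHS]mulr_natl.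
exists (~` B); split; first exact: measurableC.
  rewrite probability_setC// EFinB; exact: leeB.
move=> w m HB mN.
have nbad : ~ bad m w.
  move=> b; apply: HB; rewrite /B -(bigcup_mkord _ bad); by exists m.
have vL : sqn (vn m w) <= L.
  by rewrite leNgt; apply/negP => ?; apply: nbad; left.
split => //; rewrite leNgt; apply/negP => ?; apply: nbad; right.
by apply/andP.
Qed.

End truncated_chain.

(** * Diagonalisation of real symmetric matrices *)

Section spectral.
Context (R : rcfType).

Lemma char_poly_conj n (H A : 'M[R]_n) : H *m H = 1%:M ->
  char_poly (H *m A *m H) = char_poly A.
Proof.
move=> HH; pose Hp := map_mx polyC H.
have HpHp : Hp *m Hp = 1%:M by rewrite -map_mxM HH map_mx1.
have E : char_poly_mx (H *m A *m H) = Hp *m char_poly_mx A *m Hp.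
  rewrite /char_poly_mx mulmxBr mulmxBl !map_mxM -/Hp; congr (_ - _).
  by rewrite scalar_mxC -mulmxA HpHp mulmx1.
by rewrite /char_poly E !det_mulmx mulrAC -det_mulmx HpHp det1 mul1r.
Qed.

(** The reflection along [u - e] swaps the two unit vectors; for [u = e] it is undefined and the
    identity serves. *)
Lemma householder n (u : 'cV[R]_n.+1) : (u^T *m u) 0 0 = 1 ->
  exists H : 'M[R]_n.+1, [/\ H^T = H, H *m H = 1%:M & H *m delta_mx 0 0 = u].
Proof.
move=> u1; pose e : 'cV[R]_n.+1 := delta_mx 0 0.
have [->|ue] := eqVneq u e.
  by exists 1%:M; split; rewrite ?trmx1 ?mulmx1 ?mul1mx.
pose w := u - e; pose c : R := (w^T *m w) 0 0.
have eu : (e^T *m u) 0 0 = u 0 0.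
  rewrite mxE (bigD1 0)//= !mxE !eqxx mul1r big1 ?addr0// => i i0.
  by rewrite !mxE (negbTE i0) mul0r.
have ee : (e^T *m e) 0 0 = 1.
  rewrite mxE (bigD1 0)//= !mxE !eqxx mul1r big1 ?addr0// => i i0.
  by rewrite !mxE (negbTE i0) mul0r.
have ue' : (u^T *m e) 0 0 = u 0 0.
  by rewrite -eu !mxE; apply: eq_bigr => i _; rewrite !mxE mulrC.
have subE (x z : 'M[R]_1) : (x - z) 0 0 = x 0 0 - z 0 0 by rewrite !mxE.
have we : (w^T *m e) 0 0 = u 0 0 - 1.
  by rewrite /w linearB mulmxBl/= subE ue' ee.
have cE : c = 2 - 2 * u 0 0.
  have -> : c = (w^T *m u) 0 0 - (w^T *m e) 0 0 by rewrite -subE -mulmxBr.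
  rewrite we.
  by rewrite /w linearB/= mulmxBl subE u1 eu; ring.
have c0 : c != 0.
  apply/negP => /eqP c0; move/eqP: ue; apply; apply/subr0_eq/matrixP => i j.
  rewrite ord1 [RHS]mxE; apply/eqP; rewrite -sqrf_eq0.
  move: c0; rewrite /c mxE => /psumr_eq0P; move=> /(_ _ i isT).
  rewrite !mxE -expr2 => -> //k _; by rewrite mxE -expr2 sqr_ge0.
pose H := 1%:M - (2 / c) *: (w *m w^T).
have WW : w *m w^T *m (w *m w^T) = c *: (w *m w^T).
  rewrite -mulmxA [w^T *m _]mulmxA [w^T *m w]mx11_scalar -/c mul_scalar_mx.
  by rewrite -scalemxAr.
exists H; split.
- by rewrite /H linearB linearZ/= trmx1 trmx_mul trmxK.
- move: WW; rewrite /H; set K := w *m w^T; set s := 2 / c => WW.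
  rewrite mulmxBl mul1mx -scalemxAl mulmxBr mulmx1 -scalemxAr WW.
  apply/matrixP => i j; rewrite !mxE; move: (_ == _)%:R (K i j) => d k.
  by rewrite /s; field.
- rewrite /H mulmxBl mul1mx -scalemxAl -mulmxA [w^T *m _]mx11_scalar we.
  rewrite mul_mx_scalar scalerA [X in X *: _](_ : _ = -1).
    by rewrite scaleN1r opprK /w addrC subrK.
  by rewrite cE; field; rewrite -cE.
Qed.

(* As the characteristic polynomial splits, no complex eigenvalue is needed. *)
Lemma symmetric_diagonalizable n (A : 'M[R]_n) (l : 'I_n -> R) :
  A^T = A -> char_poly A = \prod_k ('X - (l k)%:P) ->
  exists Q : 'M[R]_n, Q^T *m Q = 1%:M /\ Q^T *m A *m Q = diag_mx (\row_k l k).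
Proof.
elim: n A l => [|n ih] A l As Al.
  by exists 1%:M; split; apply/matrixP => -[].
have : eigenvalue A (l ord0).
  rewrite eigenvalue_root_char Al; apply/rootP.
  by rewrite big_ord_recl hornerM hornerXsubC subrr mul0r.
case/eigenvalueP => v vA vn0.
pose c := (v *m v^T) 0 0.
have cE : c = \sum_k v 0 k ^+ 2.
  by rewrite /c mxE; apply: eq_bigr => k _; rewrite mxE expr2.
have c0 : 0 < c.
  rewrite lt_neqAle cE sumr_ge0 ?andbT => [|k _]; last exact: sqr_ge0.
  apply: contra vn0; rewrite eq_sym => /eqP /psumr_eq0P h.
  apply/eqP/rowP => k; rewrite mxE; apply/eqP; rewrite -sqrf_eq0; apply/eqP.
  by apply: h => // i _; exact: sqr_ge0.
pose u : 'cV[R]_n.+1 := (Num.sqrt c)^-1 *: v^T.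
have u1 : (u^T *m u) 0 0 = 1.
  have uT : u^T = (Num.sqrt c)^-1 *: v.
    by apply/matrixP => i j; rewrite !mxE.
  rewrite uT /u -scalemxAl -scalemxAr scalerA mxE -/c.
  rewrite -invfM -expr2 sqr_sqrtr ?(ltW c0)// mulVf// gt_eqF//.
have Au : A *m u = l ord0 *: u.
  rewrite /u -scalemxAr -[A]As -trmx_mul vA scalerA mulrC -scalerA.
  by congr (_ *: _); apply/matrixP => i j; rewrite !mxE.
(* Deflation: conjugation by [H] moves the eigenvector to the first basis vector, and symmetry
   clears the first row along with the first column. The order of [l] is preserved, so index 0 keeps
   the top eigenvalue. *)
have [H [Hs HH He]] := householder u1.
pose B := H *m A *m H.
have Bs : B^T = B by rewrite /B !trmx_mul Hs As mulmxA.
have Be : B *m delta_mx 0 0 = l ord0 *: delta_mx 0 (0 : 'I_1).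
  rewrite /B -!mulmxA He Au -scalemxAr; congr (_ *: _).
  by rewrite -He mulmxA HH mul1mx.
have Bl : char_poly B = \prod_k ('X - (l k)%:P) by rewrite char_poly_conj.
(* The same matrix, typed with size [1 + n] so that it can be cut into blocks. *)
have [B' B'B] : exists B' : 'M[R]_(1 + n), B' = B by exists B.
have Bcol i : B i ord0 = l ord0 * (i == ord0)%:R.
  have := congr1 (fun M : 'cV[R]_n.+1 => M i 0) Be.
  by rewrite -colE !mxE eqxx andbT.
have Bsym i j : B i j = B j i by rewrite -{1}Bs mxE.
have l0E (i : 'I_1) : lshift n i = ord0 by apply/val_inj; rewrite ord1.
have r0E (i : 'I_n) : (rshift 1 i == ord0) = false by apply/eqP => /(congr1 val).
have ulE : ulsubmx B' = (l ord0)%:M.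
  apply/matrixP => i j; rewrite !ord1 !mxE eqxx mulr1n B'B l0E Bcol eqxx.
  by rewrite mulr1.
have dlE : dlsubmx B' = 0.
  by apply/matrixP => i j; rewrite !mxE B'B l0E Bcol r0E mulr0.
have urE : ursubmx B' = 0.
  by apply/matrixP => i j; rewrite !mxE B'B l0E Bsym Bcol r0E mulr0.
have B'E : B' = block_mx (l ord0)%:M 0 0 (drsubmx B').
  by rewrite -[LHS]submxK ulE dlE urE.
pose A' := drsubmx B'.
have A's : A'^T = A' by rewrite /A' trmx_drsub; congr drsubmx; rewrite B'B.
have A'l : char_poly A' = \prod_k ('X - (l (lift ord0 k))%:P).
  have : char_poly B' = ('X - (l ord0)%:P) * char_poly A'.
    rewrite B'E /char_poly char_block_diag_mx det_ublock -/A'; congr (_ * _).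
    by rewrite -/(char_poly _) char_poly_trig ?scalar_mx_is_trig// big_ord1 mxE eqxx mulr1n.
  rewrite B'B [LHS]Bl big_ord_recl => /mulfI -> //.
  by rewrite polyXsubC_eq0.
have [Q [QQ QA]] := ih _ _ A's A'l.
pose Qb : 'M[R]_(1 + n) := block_mx 1%:M 0 0 Q.
have QbT : Qb^T = block_mx 1%:M 0 0 Q^T by rewrite /Qb tr_block_mx trmx1 !trmx0.
have QbQb : Qb^T *m Qb = 1%:M.
  rewrite QbT /Qb mulmx_block !mulmx0 !mul0mx !addr0 add0r mulmx1 QQ.
  by rewrite -scalar_mx_block.
exists (H *m (Qb : 'M[R]_n.+1)); split.
  by rewrite trmx_mul Hs mulmxA -[_ *m H *m H]mulmxA HH mulmx1.
have -> : (H *m (Qb : 'M[R]_n.+1))^T *m A *m (H *m (Qb : 'M[R]_n.+1)) = Qb^T *m B' *m Qb.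
  by rewrite trmx_mul Hs B'B /B !mulmxA.
rewrite QbT B'E -/A' /Qb !mulmx_block !mulmx0 !mul0mx !addr0 !add0r mulmx1 mul1mx.
rewrite QA; apply/matrixP => i j.
case: (@split_ordP 1 n i) => i' ->; case: (@split_ordP 1 n j) => j' ->.
- etransitivity; first exact: block_mxEul.
  by rewrite !mxE !ord1 !l0E !eqxx.
- etransitivity; first exact: block_mxEur.
  by rewrite mul0mx !mxE l0E eq_sym r0E.
- etransitivity; first exact: block_mxEdl.
  by rewrite mul0mx !mxE l0E r0E.
- etransitivity; first exact: block_mxEdr.
  have rE : (rshift 1 i' == rshift 1 j' :> 'I_n.+1) = (i' == j').
    by apply/eqP/eqP => [/(congr1 val)/= /addnI /val_inj|->].
  rewrite !mxE rE.
  by have -> : rshift 1 i' = lift ord0 i' by apply/val_inj.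
Qed.

End spectral.

(** * Samples in the eigenbasis *)

Lemma mulmx_continuous (R : realType) (m n : nat) (M : 'M[R]_(m, n)) :
  continuous (fun v : 'cV[R]_n => M *m v).
Proof.
move=> v; apply/cvg_ballP => [|e e0]; first exact: nbhs_filter.
have h i j : \forall v' \near v, ball ((M *m v) i j) e ((M *m v') i j).
  have sums s : (fun v' : 'cV[R]_n => \sum_(k <- s) M i k * v' k j) @ v -->
      \sum_(k <- s) M i k * v k j.
    elim: s => [|k s ih].
      rewrite big_nil (_ : (fun _ => _) = cst 0); first exact: (@cvg_cst R 0 _ (nbhs v) (nbhs_filter v)).
      by apply/funext => v'; rewrite big_nil.
    rewrite big_cons (_ : (fun _ => _) = fun v' : 'cV[R]_n =>
      M i k * v' k j + \sum_(l <- s) M i l * v' l j); last first.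
      by apply/funext => v'; rewrite big_cons.
    apply: (@cvgD _ _ _ _ (nbhs_filter v)) => //.
    by apply: (@cvgMl_tmp _ _ _ (nbhs_filter v)); exact: coord_continuous.
  have : (fun v' : 'cV[R]_n => (M *m v') i j) @ v --> (M *m v) i j.
    by under eq_fun do rewrite mxE; rewrite mxE; exact: sums.
  by move/cvg_ballP; apply.
have FF : Filter (nbhs v) := nbhs_filter v.
have hi i := @filter_forall _ _ _ _ FF (h i).
by apply: (@filterS _ _ FF _ _ _ (@filter_forall _ _ _ _ FF hi)) => v' hv; split.
Qed.

Lemma measurable_to_borel (R : realType) (d : nat) dT (T : measurableType dT)
    (f : T -> borel_cV R d) :
  (forall A : set 'cV[R]_d, open A -> measurable (f @^-1` A)) ->
  measurable_fun setT f.
Proof.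
move=> fA; apply: (@measurability _ _ T (borel_cV R d) setT f (@open 'cV[R]_d)) => //.
by move=> _ [A oA <-]; rewrite setTI; exact: fA.
Qed.

Lemma measurable_borel_coord (R : realType) (d : nat) (k : 'I_d) :
  measurable_fun setT (fun x : borel_cV R d => (x : 'cV[R]_d) k 0).
Proof.
apply: (@measurability _ _ _ _ _ _ _ (RGenOpens.measurableE R)).
move=> _ [_ [a [b ->]] <-]; rewrite setTI; apply: sub_sigma_algebra.
have : open `]a, b[%classic by exact: interval_open.
by move: `]a, b[%classic => A; apply: (continuousP _).1; exact: coord_continuous.
Qed.

Lemma measurable_mulmx (R : realType) (d : nat) (M : 'M[R]_d) :
  measurable_fun setT (fun x : borel_cV R d => M *m (x : 'cV[R]_d) : borel_cV R d).
Proof.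
apply: measurable_to_borel => A oA; apply: sub_sigma_algebra.
by move: A oA; apply/continuousP; exact: mulmx_continuous.
Qed.

Lemma dotvE (R : realType) d (u v : 'cV[R]_d) : dotv u v = \sum_k u k 0 * v k 0.
Proof. by rewrite /dotv mxE; apply: eq_bigr => k _; rewrite mxE. Qed.

Lemma dotvC (R : realType) d (u v : 'cV[R]_d) : dotv u v = dotv v u.
Proof. by rewrite !dotvE; apply: eq_bigr => k _; rewrite mulrC. Qed.

Lemma dotv_ge0 (R : realType) d (u : 'cV[R]_d) : 0 <= dotv u u.
Proof. by rewrite dotvE; apply: sumr_ge0 => k _; rewrite -expr2 sqr_ge0. Qed.

Lemma dotv_eq0 (R : realType) d (u : 'cV[R]_d) : dotv u u = 0 -> u = 0.
Proof.
rewrite dotvE => /psumr_eq0P h; apply/colP => k; rewrite mxE.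
apply/eqP; rewrite -sqrf_eq0 expr2; apply/eqP; apply: h => // i _.
by rewrite -expr2 sqr_ge0.
Qed.

Lemma dotvZl (R : realType) d c (u v : 'cV[R]_d) : dotv (c *: u) v = c * dotv u v.
Proof. by rewrite !dotvE mulr_sumr; apply: eq_bigr => k _; rewrite mxE mulrA. Qed.

Lemma dotvZr (R : realType) d c (u v : 'cV[R]_d) : dotv u (c *: v) = c * dotv u v.
Proof. by rewrite dotvC dotvZl dotvC. Qed.

Section subgaussian.
Context (R : realType) (d : nat) (dT : measure_display) (T : measurableType dT)
  (P : probability T R) (Z : {RV P >-> borel_cV R d}).
Hypothesis isoZ : isotropic_subgaussian Z.

Lemma measurable_rv_coord k : measurable_fun setT (fun w => (Z w : 'cV[R]_d) k 0).
Proof. by apply: (measurableT_comp (measurable_borel_coord k)). Qed.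

Lemma measurable_dotv (b : 'cV[R]_d) : measurable_fun setT (fun w => dotv b (Z w)).
Proof.
have -> : (fun w => dotv b (Z w)) = fun w => \sum_k b k 0 * (Z w : 'cV[R]_d) k 0.
  by apply/funext => w; rewrite dotvE.
by apply: measurable_sum => k; apply: measurable_funM => //; exact: measurable_rv_coord.
Qed.

(** Keep only the exponent [r = 2 * m.+1] of the supremum and raise to the power [r]: [r ^ (r / 2)]
    is the bound, and the even power removes the absolute value. *)
Lemma subgaussian_moment_sphere (v : 'cV[R]_d) m : sphere v ->
  mean_le P (fun w => dotv v (Z w) ^+ (2 * m.+1)) ((2 * m.+1)%:R ^+ m.+1).
Proof.
move=> v1; have [_ _ psi] := isoZ.
set r : R := (2 * m.+1)%:R.
have r0 : 0 < r by rewrite ltr0n muln_gt0.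
have r1 : 1 <= r by rewrite ler1n muln_gt0.
pose Y w := dotv v (Z w).
have NY : ((r `^ (- 2^-1))%:E * 'N[P]_(r%:E)[EFin \o Y] <= 1)%E.
  apply: le_trans psi; apply: le_trans (ereal_sup_ubound _); last first.
    by exists v => //; reflexivity.
  by apply: ereal_sup_ubound; exists r.
have NY2 : ('N[P]_(r%:E)[EFin \o Y] <= (r `^ 2^-1)%:E)%E.
  move: NY; rewrite -[X in (_ <= X)%E -> _](_ : ((r `^ (- 2^-1))%:E * (r `^ 2^-1)%:E = 1)%E).
    rewrite lee_pmul2l ?lte_fin ?powR_gt0//.
  by rewrite -EFinM -powRD ?addNr ?powRr0// (gt_eqF r0) implybT.
apply: ge0_mean_le.
- by apply: measurable_funX; exact: measurable_dotv.
- by move=> w; rewrite exprM exprn_ge0 ?sqr_ge0.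
have -> : (\int[P]_x (dotv v (Z x) ^+ (2 * m.+1))%:E = 'N[P]_(r%:E)[EFin \o Y] `^ r)%E.
  rewrite poweR_Lnorm ?gt_eqF//; apply: eq_integral => w _ /=.
  by rewrite powR_mulrn// -/(Y w) 2!(exprM _ 2) real_normK ?num_real.
have -> : (r ^+ m.+1)%:E = ((r `^ 2^-1)%:E `^ r)%E.
  rewrite poweR_EFin -powRrM [2^-1 * r](_ : _ = m.+1%:R) ?powR_mulrn ?(ltW r0)//.
  by rewrite /r natrM mulKf.
by apply: gt0_ler_poweR; rewrite ?(ltW r0)// ?in_itv/= ?leey ?andbT ?Lnorm_ge0 ?lee_fin ?powR_ge0.
Qed.

Lemma subgaussian_moment (b : 'cV[R]_d) m :
  mean_le P (fun w => dotv b (Z w) ^+ (2 * m.+1))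
    ((2 * m.+1)%:R ^+ m.+1 * dotv b b ^+ m.+1).
Proof.
have [b0|b0] := eqVneq (dotv b b) 0.
  rewrite b0 expr0n mulr0; apply: (eq_mean_le _ (has_mean_le (mean_cst P 0))) => w.
  rewrite (dotv_eq0 b0) dotvE big1 ?expr0n ?muln_eq0// => k _.
  by rewrite mxE mul0r.
have bp : 0 < dotv b b by rewrite lt_neqAle eq_sym b0 dotv_ge0.
have e0 : enorm b != 0 by rewrite gt_eqF// sqrtr_gt0.
have e2 : enorm b ^+ 2 = dotv b b by rewrite sqr_sqrtr// ltW.
have s : sphere ((enorm b)^-1 *: b).
  by rewrite /sphere/= {1}/enorm dotvZl dotvZr mulrA -invfM -expr2 e2 mulVf// sqrtr1.
have := mean_leZ (exprn_ge0 m.+1 (dotv_ge0 b)) (subgaussian_moment_sphere m s).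
rewrite mulrC; apply: eq_mean_le => w /=.
by rewrite dotvZl exprMn -e2 -exprM mulrA -exprMn divff// expr1n mul1r.
Qed.

End subgaussian.

Section coordinates.
Context (R : realType) (n : nat) (Sigma Sh Qm : 'M[R]_n.+1) (l : 'I_n.+1 -> R)
  (dT : measure_display) (T : measurableType dT) (Q : probability T R)
  (Z : {RV Q >-> borel_cV R n.+1}).
Hypotheses (isoZ : isotropic_subgaussian Z) (Shs : Sh^T = Sh)
  (ShSh : Sh *m Sh = Sigma) (QA : Qm^T *m Sigma *m Qm = diag_mx (\row_k l k)).

Definition coords (x : borel_cV R n.+1) (k : 'I_n.+1) : R := (Qm^T *m (x : 'cV[R]_n.+1)) k 0.

Lemma measurable_coords k : measurable_fun setT (fun x => coords x k).
Proof.
by apply: (measurableT_comp (measurable_borel_coord k) (measurable_mulmx Qm^T)).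
Qed.

Definition sample w : borel_cV R n.+1 := Sh *m (Z w : 'cV[R]_n.+1).

Lemma measurable_sample : measurable_fun setT sample.
Proof. by apply: (measurableT_comp (measurable_mulmx Sh)). Qed.

HB.instance Definition _ := isMeasurableFun.Build _ _ _ _ sample measurable_sample.

(** The samples and [Z] live on different probability spaces; this law on the state space is their
    common ground. *)
Definition sample_law : probability (borel_cV R n.+1) R := distribution Q sample.

Lemma has_mean_sample (f : borel_cV R n.+1 -> R) c : measurable_fun setT f ->
  has_mean Q (f \o sample) c -> has_mean sample_law f c.
Proof.
move=> mf [i_f fc].
have mEf : measurable_fun setT (EFin \o f) by exact/measurable_EFinP.
split; first by apply: integrable_pushforward => //; exact: measurable_sample.
rewrite -fc /Rintegral integral_pushforward//; exact: measurable_sample.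
Qed.

Lemma mean_le_sample (f : borel_cV R n.+1 -> R) c : measurable_fun setT f ->
  mean_le Q (f \o sample) c -> mean_le sample_law f c.
Proof.
move=> mf [i_f fc]; have [? e] := has_mean_sample mf (conj i_f erefl).
by split => //; rewrite e.
Qed.

(** The linear form [lin a] of the coordinates of the sample, pulled back to [Z]; its squared norm
    is [spec_form l a]. *)
Definition loading (a : 'I_n.+1 -> R) : 'cV[R]_n.+1 := Sh *m Qm *m \col_k a k.

Lemma lin_coords_sample a w : lin a (coords (sample w)) = dotv (loading a) (Z w).
Proof.
have -> : lin a (coords (sample w)) = ((\col_k a k)^T *m (Qm^T *m sample w)) 0 0.
  by rewrite mxE; apply: eq_bigr => k _; congr (_ * _); rewrite !mxE.
by rewrite /dotv /loading !trmx_mul Shs /sample !mulmxA.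
Qed.

Lemma dotv_loading a b : dotv (loading a) (loading b) = \sum_k l k * (a k * b k).
Proof.
rewrite /dotv /loading !trmx_mul Shs !mulmxA.
have -> : (\col_k a k)^T *m Qm^T *m Sh *m Sh *m Qm *m (\col_k b k) =
  (\col_k a k)^T *m (Qm^T *m Sigma *m Qm) *m (\col_k b k).
  by rewrite -ShSh !mulmxA.
rewrite QA -mulmxA mul_diag_mx mxE; apply: eq_bigr => k _; rewrite !mxE; ring.
Qed.

Lemma coords_moment a m : mean_le sample_law
  (fun x => lin a (coords x) ^+ (2 * m.+1)) ((2 * m.+1)%:R ^+ m.+1 * spec_form l a ^+ m.+1).
Proof.
apply: mean_le_sample.
  apply: measurable_funX; apply: measurable_sum => k.
  by apply: measurable_funM => //; exact: measurable_coords.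
have := subgaussian_moment isoZ (loading a) m.
have -> : dotv (loading a) (loading a) = spec_form l a.
  by rewrite dotv_loading; apply: eq_bigr => k _; rewrite expr2.
by apply: eq_mean_le => w /=; rewrite lin_coords_sample.
Qed.

Lemma has_mean_ZZ p q : has_mean Q
  (fun w => (Z w : 'cV[R]_n.+1) p 0 * (Z w : 'cV[R]_n.+1) q 0) (p == q)%:R.
Proof.
have [_ cov _] := isoZ.
have sq r : mean_le Q (fun w => (Z w : 'cV[R]_n.+1) r 0 ^+ 2)
    ((2 * 1)%:R ^+ 1 * dotv (delta_mx r 0 : 'cV[R]_n.+1) (delta_mx r 0) ^+ 1).
  apply: eq_mean_le (subgaussian_moment isoZ (delta_mx r 0) 0) => w.
  rewrite dotvE (bigD1 r)//= mxE !eqxx mul1r big1 ?addr0// => k /negbTE kr.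
  by rewrite mxE kr mul0r.
have mZ r : measurable_fun setT (fun w => (Z w : 'cV[R]_n.+1) r 0).
  exact: measurable_rv_coord.
have [isum _] := mean_leD (sq p) (sq q).
have i_f : Q.-integrable setT (EFin \o
    (fun w => (Z w : 'cV[R]_n.+1) p 0 * (Z w : 'cV[R]_n.+1) q 0)).
  apply: (le_integrable measurableT _ _ isum).
    by apply/measurable_EFinP; apply: measurable_funM.
  move=> w _ /=; rewrite lee_fin normrM.
  set a := (Z w : 'cV[R]_n.+1) p 0; set b := (Z w : 'cV[R]_n.+1) q 0.
  rewrite [leRHS]ger0_norm ?addr_ge0 ?sqr_ge0// -(real_normK (num_real a)) -(real_normK (num_real b)).
  by have := sqr_ge0 (`|a| - `|b|); have := sqr_ge0 (`|a| + `|b|); nra.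
split => //; have := cov p q; rewrite unlock [in X in _ = X]mxE => e.
transitivity (fine (\int[Q]_w (((Z w : 'cV[R]_n.+1) *m (Z w : 'cV[R]_n.+1)^T) p q)%:E)).
  congr fine; apply: eq_integral => w _.
  by rewrite mxE big_ord1 mxE.
by rewrite e.
Qed.

Lemma coords_cov j k : has_mean sample_law (fun x => coords x j * coords x k)
  ((j == k)%:R * l k).
Proof.
apply: has_mean_sample.
  by apply: measurable_funM; exact: measurable_coords.
pose b r := loading (unitv R r).
have h : has_mean Q (fun w => \sum_p \sum_q (b j p 0 * b k q 0) *
    ((Z w : 'cV[R]_n.+1) p 0 * (Z w : 'cV[R]_n.+1) q 0))
    (\sum_p \sum_q (b j p 0 * b k q 0) * (p == q)%:R).
  by apply: mean_sum => p _; apply: mean_sum => q _; apply: meanZ; exact: has_mean_ZZ.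
have -> : (j == k)%:R * l k = \sum_p \sum_q (b j p 0 * b k q 0) * (p == q)%:R.
  transitivity (dotv (b j) (b k)).
    rewrite dotv_loading (bigD1 k)//= /unitv eqxx big1 => [|i /negbTE->]; last by rewrite !mulr0.
    by rewrite mulr1 addr0 mulrC eq_sym.
  rewrite dotvE; apply: eq_bigr => p _; rewrite (bigD1 p)//= eqxx mulr1.
  by rewrite big1 ?addr0// => q; rewrite eq_sym => /negbTE->; rewrite mulr0.
apply: eq_has_mean h => w /=.
have cE r : coords (sample w) r = dotv (b r) (Z w).
  by rewrite /b -lin_coords_sample lin_unitv.
rewrite !cE !dotvE mulr_suml; apply: eq_bigr => p _.
by rewrite mulr_sumr; apply: eq_bigr => q _; rewrite /b; ring.
Qed.

End coordinates.

(** * Iterates of online PCA *)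

Lemma tan2_angle_fin (R : realType) d (u s : 'cV[R]_d) :
  dotv u s != 0 -> dotv u s ^+ 2 <= 1 ->
  tan2_angle u s = ((1 - dotv u s ^+ 2) / dotv u s ^+ 2)%:E.
Proof.
rewrite /tan2_angle /angle; set C := dotv u s => C0 C1.
have Cin : -1 <= C <= 1 by rewrite -ler_norml -(@expr_le1 _ 2)// real_normK ?num_real.
have cosC : cos (acos C) = C by rewrite acosK.
case: eqP => [h|_]; first by move: C0; rewrite -cosC h cos_pihalf eqxx.
by rewrite /tan sin_acos// cosC expr_div_n sqr_sqrtr// subr_ge0.
Qed.

(** The value [+oo] at the right angle is what allows dividing by the first coordinate of the
    initial point. *)
Lemma tan2_angle_finite (R : realType) d (u s : 'cV[R]_d) (K : R) :
  (tan2_angle u s <= K%:E)%E -> dotv u s != 0.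
Proof.
apply: contraTneq => u0; rewrite /tan2_angle /angle u0 acos0 eqxx.
by rewrite leye_eq.
Qed.

Lemma dotv_mulmx (R : realType) d (Q : 'M[R]_d) (u v : 'cV[R]_d) :
  Q *m Q^T = 1%:M -> dotv (Q^T *m u) (Q^T *m v) = dotv u v.
Proof.
by move=> QQ; rewrite /dotv trmx_mul trmxK !mulmxA -[_ *m Q *m Q^T]mulmxA QQ mulmx1.
Qed.

Section dynamics.
Context (R : realType) (n : nat) (Sigma Qm : 'M[R]_n.+1) (l : 'I_n.+1 -> R)
  (ustar : 'cV[R]_n.+1).
Hypotheses (QQ : Qm^T *m Qm = 1%:M)
  (QA : Qm^T *m Sigma *m Qm = diag_mx (\row_k l k))
  (l_lt : forall k, k != ord0 -> l k < l ord0)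
  (ustar1 : sphere ustar) (ustar_eig : Sigma *m ustar = l ord0 *: ustar).

Let QQt : Qm *m Qm^T = 1%:M. Proof. exact: mulmx1C. Qed.

Lemma dotv_sphere d (u : 'cV[R]_d) : sphere u -> dotv u u = 1.
Proof.
by rewrite /sphere/= /enorm => h; rewrite -[LHS]sqr_sqrtr ?dotv_ge0// h expr1n.
Qed.

(** The top eigenvalue is simple, so [ustar] is the first basis vector up to a sign, which
    disappears in the squared tangent. *)
Lemma coords_ustar k : k != ord0 -> coords Qm ustar k = 0.
Proof.
move=> k0; have : (diag_mx (\row_k l k) *m (Qm^T *m ustar)) k 0 =
    l ord0 * coords Qm ustar k.
  rewrite -QA -mulmxA [Qm *m _]mulmxA QQt mul1mx -mulmxA ustar_eig.
  by rewrite -scalemxAr mxE.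
rewrite mul_diag_mx mxE mxE -/(coords Qm ustar k) => /eqP.
rewrite -subr_eq0 -mulrBl mulf_eq0 subr_eq0 (lt_eqF (l_lt k0))/=.
by move/eqP.
Qed.

Lemma dotv_coords (u v : 'cV[R]_n.+1) :
  dotv u v = \sum_k coords Qm u k * coords Qm v k.
Proof. by rewrite -(dotv_mulmx _ _ QQt) dotvE. Qed.

Lemma coords_ustar0 : coords Qm ustar ord0 ^+ 2 = 1.
Proof.
rewrite -(dotv_sphere ustar1) dotv_coords (bigD1 ord0)//= big1 ?addr0 ?expr2//.
by move=> k /coords_ustar ->; rewrite mul0r.
Qed.

Lemma dotv_ustar u : dotv u ustar = coords Qm u ord0 * coords Qm ustar ord0.
Proof.
rewrite dotv_coords (bigD1 ord0)//= big1 ?addr0// => k /coords_ustar ->.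
by rewrite mulr0.
Qed.

Lemma tan2_angle_coords u (v : 'I_n.+1 -> R) : dotv u u = 1 -> v ord0 = 1 ->
  coords Qm u ord0 != 0 ->
  (forall k, coords Qm u k = coords Qm u ord0 * v k) ->
  tan2_angle u ustar = (\sum_(k < n) v (lift ord0 k) ^+ 2)%:E.
Proof.
move=> u1 v1 u0 uv; have c2 := coords_ustar0.
set z := coords Qm u ord0 in u0 uv *.
have d2 : dotv u ustar ^+ 2 = z ^+ 2 by rewrite dotv_ustar exprMn c2 mulr1.
have z1 : 1 = z ^+ 2 * (1 + \sum_(k < n) v (lift ord0 k) ^+ 2).
  rewrite -{1}u1 dotv_coords big_ord_recl mulrDr mulr1 -expr2; congr (_ + _).
  by rewrite mulr_sumr; apply: eq_bigr => k _; rewrite uv; ring.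
have z2 : 0 < z ^+ 2 by rewrite exprn_even_gt0.
have t0 : 0 <= \sum_(k < n) v (lift ord0 k) ^+ 2.
  by apply: sumr_ge0 => k _; exact: sqr_ge0.
rewrite tan2_angle_fin.
- rewrite d2; congr EFin; rewrite {1}z1 mulrDr mulr1 addrC addKr mulrC.
  by rewrite mulrA mulVf ?mul1r// gt_eqF.
- by rewrite -sqrf_eq0 d2 gt_eqF.
- rewrite d2 [leRHS]z1 ler_peMr ?(ltW z2)//; lra.
Qed.

Lemma coords_scale c u k : coords Qm (c *: u) k = c * coords Qm u k.
Proof. by rewrite /coords -scalemxAr mxE. Qed.

Lemma coords_pca beta (u x : 'cV[R]_n.+1) k :
  coords Qm (u + beta *: (x *m x^T *m u)) k =
  coords Qm u k + beta * (coords Qm x k * \sum_j coords Qm u j * coords Qm x j).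
Proof.
rewrite {1}/coords mulmxDr mxE; congr (_ + _).
rewrite -[x *m x^T *m u]mulmxA [x^T *m u]mx11_scalar mul_mx_scalar -!scalemxAr.
rewrite 2!mxE; congr (_ * _); rewrite mulrC; congr (_ * _).
by rewrite -/(dotv x u) dotvC dotv_coords.
Qed.

Lemma pca_step beta (u x : 'cV[R]_n.+1) (v : 'I_n.+1 -> R) :
  v ord0 = 1 -> coords Qm u ord0 != 0 ->
  (forall k, coords Qm u k = coords Qm u ord0 * v k) ->
  `|beta * coords Qm x ord0 * lin v (coords Qm x)| <= 1 / 2 ->
  let u' := normalize (u + beta *: (x *m x^T *m u)) in
  [/\ dotv u' u' = 1, coords Qm u' ord0 != 0 &
   forall k, coords Qm u' k = coords Qm u' ord0 * upd beta v (coords Qm x) k].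
Proof.
move=> v1 u0 uv sm u'; set y := coords Qm x in sm *.
set w := u + beta *: (x *m x^T *m u) in u' *.
have wE k : coords Qm w k = coords Qm u ord0 * (v k + beta * y k * lin v y).
  rewrite coords_pca uv -/y mulrDr; congr (_ + _).
  have -> : \sum_j coords Qm u j * y j = coords Qm u ord0 * lin v y.
    by rewrite /lin mulr_sumr; apply: eq_bigr => j _; rewrite uv mulrA.
  ring.
have pos : 0 < 1 + beta * y ord0 * lin v y.
  by move: sm => /ler_normlP[]; lra.
have w0 : coords Qm w ord0 != 0 by rewrite wE v1 mulf_neq0// gt_eqF.
have ww : 0 < dotv w w.
  rewrite dotv_coords (bigD1 ord0)//= ltr_pwDl//.
    by rewrite -expr2 exprn_even_gt0.
  by apply: sumr_ge0 => k _; rewrite -expr2 sqr_ge0.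
have e0 : 0 < enorm w by rewrite sqrtr_gt0.
split.
- by rewrite /u' /normalize dotvZl dotvZr mulrA -invfM -expr2 sqr_sqrtr ?mulVf ?gt_eqF// ltW.
- by rewrite coords_scale mulf_neq0// invr_neq0// gt_eqF.
- move=> k; rewrite !coords_scale -mulrA; congr (_ * _).
  rewrite !wE v1 -[RHS]mulrA; congr (_ * _).
  by rewrite /upd /clip_inv ifT//; field; rewrite gt_eqF.
Qed.

End dynamics.

(** * Stepsize and time scales *)

Section scalars.
Context (R : realType).

Lemma expR_half_le2 : expR (1 / 2 : R) <= 2.
Proof.
have h : 1 / 2 <= expR (- (1 / 2) : R) by have := expR_ge1Dx (- (1 / 2) : R); lra.
have e0 := expR_gt0 (1 / 2 : R).
have := expRxMexpNx_1 (1 / 2 : R).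
by have := ler_wpM2l (ltW e0) h; lra.
Qed.

Lemma ln2_ge_half : 1 / 2 <= ln 2 :> R.
Proof.
by rewrite -[leLHS]expRK ler_ln ?posrE ?expR_gt0// expR_half_le2.
Qed.

(** Through [1/3 <= 1/2 <= exp (-1/2)]; this is the origin of [C1 = 1/2]. *)
Lemma third_pow_le (M : R) p : M <= p%:R -> (1 / 3) ^+ p <= expR (- (1 / 2) * M).
Proof.
move=> Mp; apply: (@le_trans _ _ ((1 / 2) ^+ p)).
  by rewrite lerXn2r ?nnegrE//; lra.
apply: (@le_trans _ _ (expR (p%:R * - (1 / 2)))); last by rewrite ler_expR; lra.
rewrite expRM_natl lerXn2r ?nnegrE ?expR_ge0//.
by have := expR_ge1Dx (- (1 / 2) : R); lra.
Qed.

Lemma powRE (a x : R) : 0 < a -> a `^ x = expR (x * ln a).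
Proof. by move=> a0; rewrite /powR gt_eqF. Qed.

(** With [q = 1 - g], [a = r^-1] and [b = 4 * L0], the two ceilings are [Ns 1] and [No]. *)
Lemma pow_le_of_ceil (q a b : R) n : 0 < q < 1 -> 0 < a -> 0 < b ->
  Num.ceil (ln a / - ln q) + Num.ceil (ln b / - ln q) <= n%:Z ->
  q ^+ n <= (a * b)^-1.
Proof.
move=> /andP[q0 q1] a0 b0 h.
have lq : 0 < - ln q by rewrite oppr_gt0 ln_lt0// q0.
have : (ln a + ln b) / - ln q <= n%:R.
  have := h; rewrite -(ler_int R) rmorphD/= => h'.
  apply: le_trans h'; rewrite mulrDl; apply: lerD; exact: ceil_ge.
rewrite ler_pdivrMr// => h2.
rewrite -[q]lnK ?posrE// -expRM_natl -[(a * b)^-1]lnK ?posrE ?invr_gt0 ?mulr_gt0//.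
rewrite ler_expR lnV ?posrE ?mulr_gt0// lnM ?posrE//; lra.
Qed.

(** For [g <= 1/4], [(1 - 7/4 * g)^2 <= (1 - g)^3]. Hence the square of the second quantity is at
    most the cube of the first, itself at most [r / 4], which gains the extra half power of [r]. *)
Lemma geometric_decay_le (g r L0 : R) n : 0 < g -> g <= 1 / 4 -> 0 < r -> r <= 1 -> 1 <= L0 ->
  (1 - g) ^+ n <= (r^-1 * (4 * L0))^-1 ->
  (1 - g) ^+ n * L0 <= 1 /\ (1 - 7 / 4 * g) ^+ n * L0 <= r * r `^ (1 / 2).
Proof.
move=> g0 g1 r0 r1 L1 qn.
have q0 : 0 <= 1 - g by lra.
have qn0 : 0 <= (1 - g) ^+ n by exact: exprn_ge0.
have h : (1 - g) ^+ n * L0 <= r / 4.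
  have := ler_wpM2r (_ : 0 <= L0) qn; move=> /(_ _); rewrite invfM invrK invfM.
  have -> : r * (4^-1 * L0^-1) * L0 = r / 4 by field; rewrite gt_eqF; lra.
  by apply; lra.
split; first by lra.
rewrite -(@ler_sqr _ _ (r * r `^ (1 / 2))) ?nnegrE; last 2 first.
  - by rewrite mulr_ge0 ?exprn_ge0//; lra.
  - by rewrite mulr_ge0 ?powR_ge0// ltW.
have -> : (r * r `^ (1 / 2)) ^+ 2 = r ^+ 3.
  rewrite exprMn [1 / 2]mul1r powR12_sqrt ?(ltW r0)// sqr_sqrtr ?(ltW r0)//.
  by rewrite -exprSr.
rewrite exprMn -exprM mulnC exprM.
apply: (@le_trans _ _ (((1 - g) ^+ 3) ^+ n * L0 ^+ 2)).
  rewrite ler_wpM2r ?sqr_ge0// lerXn2r ?nnegrE ?sqr_ge0 ?exprn_ge0//.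
  rewrite !exprS expr0 !mulr1; nra.
rewrite -exprM mulnC exprM.
have L2 : L0 ^+ 2 <= L0 ^+ 3 by rewrite [leRHS]exprS ler_peMl ?sqr_ge0.
apply: (@le_trans _ _ (((1 - g) ^+ n) ^+ 3 * L0 ^+ 3)).
  by rewrite ler_wpM2l ?exprn_ge0.
rewrite -exprMn; apply: (@le_trans _ _ ((r / 4) ^+ 3)).
  rewrite lerXn2r ?nnegrE//; last by lra.
  by rewrite mulr_ge0//; lra.
by rewrite lerXn2r ?nnegrE//; lra.
Qed.

End scalars.

Section step_scalars.
Context (R : realType) (l1 l2 beta : R).
Hypotheses (l2_ge0 : 0 <= l2) (l12 : l2 < l1) (beta_gt0 : 0 < beta).
Let r := scaled_step l1 l2 beta.
Let g := beta * (l1 - l2).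

Lemma scaled_step_gt0 : 0 < r.
Proof.
rewrite /r /scaled_step mulr_gt0// mulr_gt0 ?invr_gt0 ?subr_gt0// exprn_gt0//.
exact: le_lt_trans l12.
Qed.

Lemma scaled_stepV : l1 ^- 2 * (l1 - l2) * beta^-1 = r^-1.
Proof. by rewrite /r /scaled_step !invfM invrK. Qed.

Lemma mul_scaled_step : (beta * l1) ^+ 2 = g * r.
Proof.
rewrite /g /r /scaled_step; field.
by rewrite gt_eqF// subr_gt0.
Qed.

Lemma mul_le_scaled_step : beta * l1 <= r.
Proof.
have l1p : 0 < l1 by exact: le_lt_trans l12.
have gp : 0 < l1 - l2 by rewrite subr_gt0.
have -> : r = beta * l1 * (l1 / (l1 - l2)) by rewrite /r /scaled_step; field; rewrite gt_eqF.
have bl0 : 0 <= beta * l1 by rewrite ltW// mulr_gt0.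
rewrite ler_peMr// ler_pdivlMr//.
by rewrite mul1r lerBlDr lerDl.
Qed.

Lemma gap_le_scaled_step : g <= r.
Proof.
apply: le_trans mul_le_scaled_step; rewrite /g; apply: ler_wpM2l; first exact: ltW.
by rewrite lerBlDr lerDl.
Qed.

End step_scalars.

Lemma scaled_step_small (R : realType) (d : nat) (r cstar eps : R) :
  (0 < d)%N -> 0 < r -> 1 < cstar -> 0 < eps < 1 / 8 ->
  d%:R * r `^ (1 - 2 * eps) <= 1 / 10 ^+ 9 / cstar ->
  r <= 1 /\ exists p, r `^ (- 2 * eps) <= p.+1%:R /\
    r * (cstar * d%:R) * p.+1%:R <= 2 / 10 ^+ 9.
Proof.
move=> d0 r0 c1 /andP[e0 e8] h.
have d1 : 1 <= d%:R :> R by rewrite ler1n.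
have h2 : cstar * d%:R * r `^ (1 - 2 * eps) <= 1 / 10 ^+ 9.
  have c0 : 0 < cstar by lra.
  move: h; rewrite ler_pdivlMr//; congr (_ <= _); ring.
have x0 : 0 <= r `^ (1 - 2 * eps) by exact: powR_ge0.
have h3 : r `^ (1 - 2 * eps) <= 1 / 10 ^+ 9.
  apply: le_trans h2; rewrite ler_peMl//.
  by have := ler_wpM2l (_ : 0 <= cstar) d1; move=> /(_ _); lra.
have r1 : r <= 1.
  rewrite leNgt; apply/negP => r1.
  have : 1 <= r `^ (1 - 2 * eps).
    rewrite -[leLHS](powRr0 r); apply: ler_powR; [exact: ltW|lra].
  lra.
split => //; set M := r `^ (- 2 * eps).
have M1 : 1 <= M.
  rewrite /M powRE// -[leLHS]expR0 ler_expR; have := ln_le0 r1; nra.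
(* As [M >= 1], [p.+1] lies between [M] and [2 * M]; with [r * M = r ^ (1 - 2 eps)] the assumption
   on the step gives the bound, the 2 in the conclusion being this factor. *)
exists (Num.truncn M); split; first by rewrite ltW// truncnS_gt.
have pM : (Num.truncn M).+1%:R <= 2 * M.
  have /andP[tM _] := truncn_itv (le_trans ler01 M1).
  by rewrite -natr1; lra.
have rM : r * M = r `^ (1 - 2 * eps).
  rewrite /M !powRE// -[X in X * _]lnK ?posrE// -expRD; congr expR; ring.
have rc : 0 <= r * (cstar * d%:R).
  by rewrite !mulr_ge0// ltW//; lra.
apply: le_trans (ler_wpM2l rc pM) _.
have -> : r * (cstar * d%:R) * (2 * M) = 2 * (cstar * d%:R * (r * M)) by ring.
by rewrite rM; lra.
Qed.

(** * Assembly of the constants, the good event and the expectation bound *)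

Lemma absorb_decay_le (R : realType) (x q A B : R) :
  q <= 1 -> 0 <= A -> x <= B -> 0 <= B ->
  x + 384 * (1 + q) * A <= 0 + 768 * (A + B).
Proof. by move=> q1 A0 xB B0; have := ler_wpM2r A0 q1; lra. Qed.

Theorem theorem1 (R : realType) :
  exists b1 C0 C1 C2 : R,
    [/\ 0 < b1 < ln 2 ^+ 2 / 16, 0 < C0, 0 < C1 & 0 < C2] /\
    forall (d : nat) (Sigma Sigma_half : 'M[R]_d) (lam : nat -> R)
      (ustar : 'cV[R]_d)
      (dQ : measure_display) (OmegaZ : measurableType dQ)
      (Q : probability OmegaZ R) (Z : {RV Q >-> borel_cV R d})
      (dP : measure_display) (Omega : measurableType dP)
      (P : probability Omega R) (X : nat -> {RV P >-> borel_cV R d})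
      (u0 : 'cV[R]_d) (cstar : R),
    (2 <= d)%N ->
    psd Sigma ->
    has_eigenvalues Sigma lam ->
    lam 2%N < lam 1%N ->
    (forall j k, (2 <= j)%N -> (j <= k)%N -> (k <= d)%N -> lam k <= lam j) ->
    0 <= lam d ->
    sphere ustar -> Sigma *m ustar = lam 1%N *: ustar ->
    is_psd_sqrt Sigma Sigma_half ->
    isotropic_subgaussian Z ->
    iid_copies X Q (fun w => Sigma_half *m (Z w : 'cV[R]_d) : borel_cV R d) ->
    sphere u0 ->
    1 < cstar ->
    (tan2_angle u0 ustar <= (cstar * d%:R)%:E)%E ->
    forall eps beta t : R,
    0 < eps < 1 / 8 ->
    0 < beta ->
    d%:R * scaled_step (lam 1%N) (lam 2%N) beta `^ (1 - 2 * eps)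
      <= b1 / cstar ->
    1 < t ->
    let gap := lam 1%N - lam 2%N in
    let r := scaled_step (lam 1%N) (lam 2%N) beta in
    let Ns s := Nstar (lam 1%N) (lam 2%N) beta s in
    let No := Nout d (lam 1%N) (lam 2%N) beta cstar in
    exists H : set Omega,
      [/\ measurable H,
          ((1 - 2 * (d + 2)%:R * No%:~R * expR (- C0 * r `^ (- 2 * eps))
              - 4 * d%:R * (Ns t)%:~R * expR (- C1 * r `^ (- 2 * eps)))%:E
           <= P H)%E
        & forall n : nat, Ns 1 + No <= n%:Z -> n%:Z <= Ns t ->
          (\int[P]_(w in H)
             tan2_angle (online_pca beta u0 (fun k => X k w) n) ustar
           <= ((1 - beta * gap) ^ (2 * (n%:Z - No))
               + C2 * \sum_(2 <= k < d.+1)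
                   (lam 1%N * lam k + lam 1%N ^+ 2 * r `^ (1 / 2 - 4 * eps))
                     / (lam 1%N - lam k) * beta)%:E)%E].
Proof.
(* The failure probability is absorbed by the C1 term and the initial decay by
   the C2 sum, so C0 is arbitrary. *)
exists (1 / 10 ^+ 9), 1, (1 / 2), 768; split.
  have e9 : 0 < 1 / 10 ^+ 9 :> R by lra.
  have e16 : 1 / 10 ^+ 9 < 1 / 64 :> R by lra.
  have l64 : 1 / 64 <= ln 2 ^+ 2 / 16 :> R.
    have l2 := ln2_ge_half R.
    have : (1 / 2) ^+ 2 <= ln 2 ^+ 2 :> R by rewrite lerXn2r ?nnegrE//; lra.
    by lra.
  by split; [rewrite e9 (lt_le_trans e16)|exact: ltr01|lra|lra].
move=> [|n] Sigma Sh lam ustar dQ OmegaZ Q Z dP Omega P X u0 cstar d2; first by [].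
move=> [Sigs _] eigS gap0 mono lamd us usE [[Shs _] ShSh] isoZ [Xindep Xlaw].
move=> u0s c1 tan0 eps beta t heps b0 hr t1 gap r Ns No.
have l2ge0 : 0 <= lam 2%N by apply: le_trans lamd _; apply: mono.
(* Ordinals start at 0 and [lam] at 1: [l ord0] is the top eigenvalue, and [lift ord0 k] carries
   index [k + 2]. *)
pose l (k : 'I_n.+1) := lam k.+1.
have l_lt k : k != ord0 -> l k < l ord0.
  move=> k0; apply: le_lt_trans gap0; apply: mono => //.
  by rewrite ltnS lt0n; apply: contra k0 => /eqP k0; apply/eqP/val_inj.
have l_le k : l k <= l ord0.
  by have [->//|/l_lt/ltW] := eqVneq k ord0.
have l_ge0 k : 0 <= l k.
  have [->|k0] := eqVneq k ord0; first by apply: ltW; exact: le_lt_trans gap0.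
  apply: le_trans lamd _; apply: mono => //.
  by rewrite ltnS lt0n; apply: contra k0 => /eqP k0; apply/eqP/val_inj.
have l0 : 0 < l ord0 by exact: le_lt_trans gap0.
have charS : char_poly Sigma = \prod_k ('X - (l k)%:P).
  by rewrite eigS big_add1/= big_mkord.
have [Qm [QQ QA]] := symmetric_diagonalizable Sigs charS.
have r0 : 0 < r by exact: scaled_step_gt0.
have [r1 [p [pM small]]] := scaled_step_small (ltn0Sn n) r0 c1 heps hr.
set L0 := cstar * n.+1%:R in small tan0 *.
set M := r `^ (- 2 * eps) in pM *.
pose g := beta * gap.
have g0 : 0 < g by rewrite mulr_gt0// subr_gt0.
have gr : g <= r by exact: gap_le_scaled_step.
have dL0 : n.+1%:R <= L0 by rewrite ler_peMl// ltW.
have L01 : 1 <= L0 by apply: le_trans dL0; rewrite ler1n.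
have rsmall : r <= 2 / 10 ^+ 9.
  have p1 : 1 <= p.+1%:R :> R by rewrite ler1n.
  have rL : r <= r * L0 by rewrite ler_peMr// ltW.
  have rL0 : 0 <= r * L0.
    by apply: mulr_ge0; [exact: ltW|clear -L01; lra].
  by move: (ler_wpM2l rL0 p1) rL small; clear; lra.
have g1 : g <= 1 / 4 by move: rsmall gr; clear; lra.
have u0u0 := dotv_sphere u0s.
have z0 : coords Qm u0 ord0 != 0.
  have := tan2_angle_finite tan0; rewrite (dotv_ustar QQ QA l_lt usE).
  by apply: contraNneq => ->; rewrite mul0r.
pose v0 : n.+1.-tuple R := [tuple coords Qm u0 k / coords Qm u0 ord0 | k < n.+1].
have v01 : tnth v0 ord0 = 1 by rewrite tnth_mktuple divff.
have v0E k : coords Qm u0 k = coords Qm u0 ord0 * tnth v0 k.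
  by rewrite tnth_mktuple mulrC divfK.
have v0L : sqn (tnth v0) <= 1 + L0.
  move: tan0; rewrite (tan2_angle_coords QQ QA l_lt us usE u0u0 v01 z0 v0E) lee_fin.
  by rewrite sqnE v01 expr1n lerD2l.
have bl := mul_le_scaled_step l2ge0 gap0 b0.
have bl2 := mul_scaled_step beta gap0.
have g_gap (k : 'I_n.+1) : k != ord0 -> g <= beta * (l ord0 - l k).
  move=> k0; apply: ler_wpM2l; first exact: ltW.
  rewrite lerD2l lerN2; apply: mono => //.
  by rewrite ltnS lt0n; apply: contra k0 => /eqP k0; apply/eqP/val_inj.
have n0 : (0 < n)%N by [].
have ycov := coords_cov isoZ Shs ShSh QA.
have ymom := coords_moment isoZ Shs ShSh QA.
have my := measurable_coords Qm.
have Xmu m A : measurable A -> P (X m @^-1` A) = sample_law Sh Z A by exact: Xlaw.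
have mean := truncated_chain_mean l_ge0 l_le l0 my ycov ymom Xindep Xmu
  v01 v0L b0 g0 gr bl bl2 g_gap n0 dL0 small.
(* The event covers all steps before [Ns t], since a single [H] must serve every admissible time. *)
have [H [mH PH good]] := truncated_chain_event l_ge0 l_le l0 my ycov ymom Xindep Xmu
  v01 v0L b0 g0 gr bl2 g_gap n0 dL0 small `|Ns t|%N.
pose vn m w := tnth (chain (ratio_step (coords Qm) beta (7 * L0)) v0 (fun k => X k w) m).
rewrite -/vn in mean good.
have q01 : 0 < 1 - beta * gap < 1.
  by rewrite -/g; apply/andP; split; clear -g0 g1; lra.
have lq : 0 < - ln (1 - beta * gap) by rewrite oppr_gt0 ln_lt0.
have lnr : 0 <= ln r^-1 by rewrite ln_ge0// invf_ge1.
have Ns0 : 0 <= Ns t.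
  rewrite /Ns /Nstar scaled_stepV ceil_ge0 (lt_le_trans (ltrN10 R))//.
  by rewrite divr_ge0 ?(ltW lq)// mulr_ge0//; clear -t1; lra.
have L0E : 4 * cstar * n.+1%:R = 4 * L0 by rewrite /L0 mulrA.
have No0 : 0 <= No.
  rewrite /No /Nout L0E ceil_ge0 (lt_le_trans (ltrN10 R))//.
  by rewrite divr_ge0 ?(ltW lq)// ln_ge0//; clear -L01; lra.
exists H; split => //.
  apply: le_trans PH; rewrite lee_fin.
  have NsE : (Ns t)%:~R = `|Ns t|%N%:R :> R by rewrite -{1}(gez0_abs Ns0).
  have No0' : 0 <= No%:~R :> R by rewrite ler0z.
  rewrite NsE; set N := `|Ns t|%N%:R.
  have N0 : 0 <= N by rewrite ler0n.
  have pe := third_pow_le pM; set e := expR (- (1 / 2) * M) in pe *.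
  have a0 : 0 <= 2 * (n.+1 + 2)%:R * No%:~R * expR (- 1 * M).
    by rewrite !mulr_ge0// expR_ge0.
  have e0 : 0 <= N * e by rewrite mulr_ge0// expR_ge0.
  have d1 : 1 <= n.+1%:R :> R by rewrite ler1n.
  by move: (ler_wpM2l N0 pe) (ler_wpM2r e0 d1) (a0) (e0); clear; lra.
move=> m m1 m2.
have mN : (m <= `|Ns t|)%N by rewrite -lez_nat gez0_abs.
have vn0 j w : vn j w ord0 = 1.
  by elim: j => [|j ih] //=; exact: ratio_step_ord0.
have link w : H w -> forall j, (j <= m)%N ->
  let u := online_pca beta u0 (fun k => X k w) j in
  [/\ dotv u u = 1, coords Qm u ord0 != 0 &
     forall k, coords Qm u k = coords Qm u ord0 * vn j w k].
  move=> Hw; elim => [|j ih] jm; first by split.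
  have [uu uz uv] := ih (ltnW jm).
  have [vL cl] := good w j Hw (leq_trans jm mN).
  have [uu' uz' uv'] := pca_step QQ (vn0 j w) uz uv cl.
  split => // k; rewrite [LHS]uv'; congr (_ * _).
  by rewrite /vn/= tnth_ratio_step vL.
have tanE w : H w -> tan2_angle (online_pca beta u0 (fun k => X k w) m) ustar =
    (\sum_(k < n) vn m w (lift ord0 k) ^+ 2)%:E.
  move=> Hw; have [uu uz uv] := link w Hw m (leqnn m).
  exact: (tan2_angle_coords QQ QA l_lt us usE uu (vn0 m w) uz uv).
have mv : measurable_fun setT (fun w => \sum_(k < n) vn m w (lift ord0 k) ^+ 2).
  by have [/integrableP[/measurable_EFinP]] := mean m.
(* On [H] the squared tangent is that of the chain; being nonnegative, it may then be integrated
   over the whole space. *)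
apply: (@le_trans _ _ (\int[P]_w (\sum_(k < n) vn m w (lift ord0 k) ^+ 2)%:E)%E).
  rewrite (eq_integral (fun w => (\sum_(k < n) vn m w (lift ord0 k) ^+ 2)%:E)); last first.
    by move=> w; rewrite inE => /tanE.
  apply: ge0_subset_integral => //; first exact/measurable_EFinP.
  by move=> w _; rewrite lee_fin; apply: sumr_ge0 => k _; exact: sqr_ge0.
apply: le_trans (mean_le_integral (mean m)) _; rewrite lee_fin.
have qn : (1 - g) ^+ m <= (r^-1 * (4 * L0))^-1.
  apply: pow_le_of_ceil; rewrite ?invr_gt0//; first by clear -L01; lra.
  by move: m1; rewrite /Ns /Nstar /No /Nout scaled_stepV L0E mul1r.
have [q1 q2] := geometric_decay_le g0 g1 r0 r1 L01 qn.
have pre : 0 <= (1 - beta * gap) ^ (2 * (m%:Z - No)).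
  by apply: exprz_ge0; rewrite -/g; clear -g1; lra.
apply: (@le_trans _ _ (0 + 768 * \sum_(2 <= k < n.+2) (lam 1%N * lam k +
  lam 1%N ^+ 2 * r `^ (1 / 2 - 4 * eps)) / (lam 1%N - lam k) * beta)); last first.
  by rewrite lerD2r.
have -> : \sum_(2 <= k < n.+2) (lam 1%N * lam k + lam 1%N ^+ 2 * r `^ (1 / 2 - 4 * eps))
    / (lam 1%N - lam k) * beta = \sum_(k < n) beta * l ord0 * l (lift ord0 k) / (l ord0 - l (lift ord0 k))
   + \sum_(k < n) r `^ (1 / 2 - 4 * eps) * (l ord0 ^+ 2 / (l ord0 - l (lift ord0 k)) * beta).
  rewrite -[2%N]/(0 + 2)%N big_addn subn2/= big_mkord -big_split/=.
  apply: eq_bigr => k _; rewrite addn2 /l/= /bump/= add1n.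
  by rewrite mulrDl mulrDl; congr (_ + _); ring.
have pw : r `^ (1 / 2) <= r `^ (1 / 2 - 4 * eps).
  have /andP[e0 _] := heps; rewrite !powRE// ler_expR.
  by move: (mulr_ge0 (ltW e0) lnr); rewrite lnV ?posrE//; clear; lra.
have tk k : 0 <= r `^ (1 / 2 - 4 * eps) * (l ord0 ^+ 2 / (l ord0 - l (lift ord0 k)) * beta).
  rewrite mulr_ge0 ?powR_ge0// mulr_ge0 ?(ltW b0)// divr_ge0 ?sqr_ge0//.
  by rewrite subr_ge0.
set A := \sum_(k < n) beta * _ * _ / _; set B := \sum_(_ < n) _.
have A0 : 0 <= A.
  apply: sumr_ge0 => k _; apply: divr_ge0; last by rewrite subr_ge0.
  by apply: mulr_ge0 => //; apply: mulr_ge0; exact: ltW.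
(* The term of the second eigenvalue alone suffices: its factor [lam_1^2 / (lam_1 - lam_2) * beta]
   is exactly [r]. *)
have qB : (1 - 7 / 4 * g) ^+ m * L0 <= B.
  apply: (le_trans q2); apply: (le_trans (ler_wpM2l (ltW r0) pw)).
  rewrite /B (bigD1 (Ordinal n0))//=.
  have -> : l ord0 ^+ 2 / (l ord0 - l (lift ord0 (Ordinal n0))) * beta = r by [].
  by rewrite mulrC lerDl; apply: sumr_ge0 => k _; exact: tk.
apply: absorb_decay_le => //; apply: le_trans qB.
by apply: mulr_ge0; [apply: exprn_ge0|]; clear -g1 L01; lra.
Qed.
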